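(* Let $(p_k\mid k\geqslant 3,\ k\ne 6)$ be a sequence of nonnegative integers with $p_3=0$ satisfying $$3p_3+2p_4+p_5=12+\sum_{k\geqslant 7}(k-6)p_k.$$ Then there exists a value of $p_6$ and a flag simple $3$-polytope $P^3$ such that $p_k=p_k(P^3)$ for all $k\geqslant 3$.
   Context: For a $3$-polytope $P$, $p_k(P)$ denotes the number of its $2$-dimensional faces (facets) that are $k$-gons. A $3$-polytope is simple if every vertex lies in exactly $3$ facets. A simple polytope is flag if every set of pairwise intersecting facets has nonempty common intersection. *)

(* Defs.v *)
From HB Require Import structures.
From mathcomp Require Import all_boot all_order all_algebra.
From mathcomp Require Import boolp reals.
Set Implicit Arguments. Unset Strict Implicit. Unset Printing Implicit Defensive.
Import Order.TTheory GRing.Theory Num.Theory.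
Local Open Scope ring_scope.

(* A convex 3-polytope is given by its vertices: an injective family
   pos : 'I_n -> R^3 (row vectors) of points in convex position,
   whose convex hull is 3-dimensional. *)

Definition dot (R : realType) (u v : 'rV[R]_3) : R := (u *m v^T) 0 0.

Definition convex_position (R : realType) (n : nat) (pos : 'I_n -> 'rV[R]_3) : Prop :=
  forall i : 'I_n, exists (a : 'rV[R]_3) (b : R),
    dot (pos i) a = b /\ forall j : 'I_n, j != i -> dot (pos j) a < b.

Definition full_dim (R : realType) (n : nat) (pos : 'I_n -> 'rV[R]_3) : Prop :=
  exists i0 i1 i2 i3 : 'I_n,
    \rank (col_mx (pos i1 - pos i0)
             (col_mx (pos i2 - pos i0) (pos i3 - pos i0))) = 3%N.

Definition is_polytope3 (R : realType) (n : nat) (pos : 'I_n -> 'rV[R]_3) : Prop :=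
  convex_position pos /\ full_dim pos.

Definition is_facet (R : realType) (n : nat) (pos : 'I_n -> 'rV[R]_3)
    (F : {set 'I_n}) : Prop :=
  (exists (a : 'rV[R]_3) (b : R), a != 0 /\
     (forall i, dot (pos i) a <= b) /\
     F = [set i | dot (pos i) a == b]) /\
  exists i0 i1 i2 : 'I_n, [/\ i0 \in F, i1 \in F, i2 \in F &
     \rank (col_mx (pos i1 - pos i0) (pos i2 - pos i0)) = 2%N].

Definition in_hull (R : realType) (n : nat) (pos : 'I_n -> 'rV[R]_3)
    (A : {set 'I_n}) (x : 'rV[R]_3) : Prop :=
  exists w : 'I_n -> R,
    [/\ forall i, 0 <= w i, forall i, i \notin A -> w i = 0,
        \sum_i w i = 1 & x = \sum_i w i *: pos i].

(* p_k(P): number of facets that are k-gons (a facet with vertex set F,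
   the vertices being in convex position, is a #|F|-gon). *)
Definition pk (R : realType) (n : nat) (pos : 'I_n -> 'rV[R]_3) (k : nat) : nat :=
  #|[set F : {set 'I_n} | `[< is_facet pos F >] && (#|F| == k)]|.

Definition simple_polytope (R : realType) (n : nat) (pos : 'I_n -> 'rV[R]_3) : Prop :=
  forall i : 'I_n, #|[set F : {set 'I_n} | `[< is_facet pos F >] && (i \in F)]| = 3%N.

Definition flag_polytope (R : realType) (n : nat) (pos : 'I_n -> 'rV[R]_3) : Prop :=
  forall Fs : {set {set 'I_n}},
    (forall F, F \in Fs -> is_facet pos F) ->
    (forall F G, F \in Fs -> G \in Fs -> exists x, in_hull pos F x /\ in_hull pos G x) ->
    exists x, forall F, F \in Fs -> in_hull pos F x.

(* Main.v *)
(* All polytopes are obtained from a tetrahedron by cutting one fixed outer facet again and again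
   by a chord, which geometrically is a small tilt of a copy of its plane. If [x], [M], [y], [r]
   are the sizes of the facets met cyclically around the outer facet, a chord from [x] to [y] turns
   this word into [x + 1], [size M + 3], [y + 1], [r], and the facets of [M] become final. Chords
   with nonempty [M] and [r] preserve flagness.
   Up to facets of size 6, a facet of size 5 in the word is straight and one of size 4 is a corner.
   Finishing a facet of size [k] creates [k - 6] corners; three corners can be brought together
   and replaced by one at the price of a quadrangle, and a pentagon removes one corner. After all
   the large facets have been placed, the corners are eliminated in this way, which leaves
   a hexagonal tube, and the tube is closed by six pentagons or three quadrangles. The latter needs
   a tube whose circumference is suitable modulo 3: if all faces are even this is forced by
   the monodromy of 3-colourings, otherwise the position of one odd face is adjusted. *)

Require Import Defs.
From mathcomp Require Import all_boot all_order all_algebra.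
From mathcomp Require Import boolp reals zify ring lra.
Set Implicit Arguments. Unset Strict Implicit. Unset Printing Implicit Defensive.
Import Order.TTheory GRing.Theory Num.Theory.

(** * Words around the outer face *)

(** The sum of [5 - d] over the word changes under a chord by the sum of [m - 6] over the covered
    facets [m]: the two ends contribute [-2] and the new facet [2 - size M]. The prescribed equation
    is the same balance for the whole polytope, so once the start and the cap are set aside,
    spending all other facets leaves exactly the corners from which the cap begins. A plain chord
    does not enlarge the facets it covers. To finish a facet [z] with a larger size, vertices have
    to be cut off along it; each such cut is a triangle, which destroys flagness until [z] itself is
    covered. Hence [steps_fan] performs [j] cuts and the final chord as one move. The prism over an
    [n]-gon with [n = 4] or [n = 5] is the start because its finished [n]-gon can be spent as one of
    the prescribed quadrangles or pentagons. A chord is chosen in the word but has to separate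
    points in the plane of the outer facet; this is why the convex cyclic order of the outer
    vertices is carried along with the realization. *)

Ltac cats := repeat rewrite -?cats1 /= -?catA /=.

Definition non6 (s : seq nat) : seq nat := [seq d <- s | d != 6].

(* Words list cyclically the sizes of the facets around the outer one; [E] collects the sizes, other
   than 6, of the facets that no longer touch the outer one. *)
Inductive steps (w : seq nat) : seq nat -> seq nat -> Prop :=
| steps_refl : steps w [::] w
| steps_perm E E' w' : steps w E w' -> perm_eq E E' -> steps w E' w'
| steps_rot E u v : steps w E (u ++ v) -> steps w E (v ++ u)
| steps_cover E x M y r : steps w E (x :: M ++ y :: r) -> M != [::] -> r != [::] ->
    steps w (non6 M ++ E) [:: x.+1, size M + 3, y.+1 & r]
| steps_fan E x z y j r : steps w E [:: x, z, y & r] -> r != [::] ->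
    steps w (non6 [:: z + j] ++ E) (x.+1 :: nseq j.+1 4 ++ y.+1 :: r).

Lemma steps_trans w1 E1 w2 E2 w3 :
  steps w1 E1 w2 -> steps w2 E2 w3 -> steps w1 (E1 ++ E2) w3.
Proof.
move=> s12; elim=> {E2 w3}.
- by rewrite cats0.
- move=> E E' w' _ IH pE; apply: steps_perm IH _; by rewrite perm_cat2l.
- by move=> E u v _ IH; apply: steps_rot.
- move=> E x M y r _ IH M0 r0; apply: steps_perm (steps_cover IH M0 r0) _.
  by rewrite perm_catCA.
- move=> E x z y j r _ IH r0; apply: steps_perm (steps_fan j IH r0) _.
  by rewrite perm_catCA.
Qed.

Lemma steps_trans0 w1 w2 E w3 : steps w1 [::] w2 -> steps w2 E w3 -> steps w1 E w3.
Proof. by move=> s1 s2; apply: (steps_trans s1 s2). Qed.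

Lemma steps_trans_0 w1 w2 E w3 : steps w1 E w2 -> steps w2 [::] w3 -> steps w1 E w3.
Proof. by move=> s1 s2; rewrite -[E]cats0; apply: steps_trans s1 s2. Qed.

Lemma rotate u v : steps (u ++ v) [::] (v ++ u).
Proof. by apply/steps_rot/steps_refl. Qed.

Lemma rotate_eq w u v w' : w = u ++ v -> w' = v ++ u -> steps w [::] w'.
Proof. by move=> -> ->; apply: rotate. Qed.

Lemma steps_size w E w' : steps w E w' -> 4 <= size w -> 4 <= size w'.
Proof.
move=> st w4; elim: st => // {E w'}.
- by move=> E u v _; rewrite !size_cat addnC.
- by move=> E x M [|y] r _ _ _; case: r.
- by move=> E x z y j [|y' r] // _ _ _ /=; rewrite size_cat /= !addnS.
Qed.

Lemma cover x M y r : M != [::] -> r != [::] ->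
  steps (x :: M ++ y :: r) (non6 M) [:: x.+1, size M + 3, y.+1 & r].
Proof.
by move=> M0 r0; have := steps_cover (steps_refl _) M0 r0; rewrite cats0; apply.
Qed.

Lemma fan x z y j r : r != [::] ->
  steps [:: x, z, y & r] (non6 [:: z + j]) (x.+1 :: nseq j.+1 4 ++ y.+1 :: r).
Proof.
by move=> r0; have := steps_fan j (steps_refl [:: x, z, y & r]) r0; rewrite cats0.
Qed.

(** A move confined to a stretch of the word. The rest has to be nonempty because a chord must leave
    a facet on its far side. *)
Definition seg (s E t : seq nat) : Prop :=
  forall r, r != [::] -> steps (s ++ r) E (t ++ r).

Lemma seg_refl s : seg s [::] s.
Proof. by move=> r _; apply: steps_refl. Qed.

Lemma seg_trans0 s1 s2 E s3 : seg s1 [::] s2 -> seg s2 E s3 -> seg s1 E s3.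
Proof. by move=> h1 h2 r r0; apply: steps_trans0 (h1 r r0) (h2 r r0). Qed.

Lemma seg_trans_0 s1 s2 E s3 : seg s1 E s2 -> seg s2 [::] s3 -> seg s1 E s3.
Proof. by move=> h1 h2 r r0; apply: steps_trans_0 (h1 r r0) (h2 r r0). Qed.

Lemma cat_nil_l (a b : seq nat) : a != [::] -> a ++ b != [::].
Proof. by case: a. Qed.

Lemma cat_nil_r (a b : seq nat) : b != [::] -> a ++ b != [::].
Proof. by case: a. Qed.

Lemma seg_in p q s E t r : seg s E t -> q ++ r ++ p != [::] ->
  steps (p ++ s ++ q ++ r) E (p ++ t ++ q ++ r).
Proof.
move=> h qrp; apply: (@steps_trans0 _ (s ++ (q ++ r ++ p))).
  by apply: (@rotate_eq _ p (s ++ q ++ r)); rewrite -?catA.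
apply: steps_trans_0 (h _ qrp) _.
by apply: (@rotate_eq _ (t ++ q ++ r) p); rewrite -?catA.
Qed.

Lemma seg_ctx p q s E t : seg s E t -> seg (p ++ s ++ q) E (p ++ t ++ q).
Proof.
move=> h r r0; rewrite -!catA; apply: seg_in => //.
by apply: cat_nil_r; apply: cat_nil_l.
Qed.

Lemma seg_pre p s E t : seg s E t -> seg (p ++ s) E (p ++ t).
Proof. by move=> h; have := seg_ctx p [::] h; rewrite !cats0. Qed.

Lemma seg_suf q s E t : seg s E t -> seg (s ++ q) E (t ++ q).
Proof. exact: (@seg_ctx [::] q). Qed.

Lemma seg_mid p q s E t : seg s E t -> p ++ q != [::] ->
  steps (p ++ s ++ q) E (p ++ t ++ q).
Proof.
move=> h pq; rewrite -[q]cats0; apply: seg_in => //=.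
by case: q pq => //; rewrite cats0.
Qed.

Lemma seg_cover x M y : M != [::] -> seg (x :: M ++ [:: y]) (non6 M) [:: x.+1; size M + 3; y.+1].
Proof. by move=> M0 r r0; rewrite /= -catA; apply: cover. Qed.

Lemma seg_fan x z y j : seg [:: x; z; y] (non6 [:: z + j]) (x.+1 :: nseq j.+1 4 ++ [:: y.+1]).
Proof. by move=> r r0; have := fan x z y j r0; rewrite /= -catA. Qed.

(** * Rows of hexagons: moving and merging corners *)

Definition fives (a : nat) : seq nat := nseq a 5.

Lemma fivesD a b : fives (a + b) = fives a ++ fives b.
Proof. by rewrite /fives nseqD. Qed.

Lemma fives_cat a r : fives a ++ 5 :: r = 5 :: fives a ++ r.
Proof. by elim: a => //= a ->. Qed.

Lemma fivesSr a : fives a.+1 = fives a ++ [:: 5].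
Proof. by rewrite fives_cat cats0. Qed.

Lemma fours_cat a r : nseq a 4 ++ 4 :: r = 4 :: nseq a 4 ++ r.
Proof. by elim: a => //= a ->. Qed.

(** The pair [6], [4] is the end of an unfinished row of hexagons: covering the [6] by a chord from
    the preceding [5] to the [4] shifts the pair one place to the left. *)
Lemma seg_travel a : seg (fives a ++ [:: 6; 4]) [::] ([:: 6; 4] ++ fives a).
Proof.
elim: a => [|a IH]; first exact: seg_refl.
rewrite {1}fivesSr -catA; apply: (@seg_trans0 _ (fives a ++ [:: 6; 4; 5])).
  exact: (@seg_pre (fives a) _ _ _ (@seg_cover 5 [:: 6] 4 isT)).
have := @seg_suf [:: 5] _ _ _ IH.
by rewrite /= -!catA fives_cat cats0.
Qed.

(** The row ends at a corner: there the [6] stands between two fours, and covering it leaves a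
    single corner. *)
Lemma seg_absorb a : seg (4 :: fives a ++ [:: 6; 4]) [::] [:: 5, 4 & fives a.+1].
Proof.
apply: seg_trans0 (@seg_pre [:: 4] _ _ _ (@seg_travel a)) _.
have := @seg_suf (fives a) _ _ _ (@seg_cover 4 [:: 6] 4 isT).
by [].
Qed.

(** One full row of hexagons along the side between two corners: a [5] next to the right corner is
    finished as a hexagon, and the row so begun is absorbed by the left corner. The side loses one
    [5]. *)
Lemma seg_row a : seg (4 :: fives a.+1 ++ [:: 4]) [::] ([:: 5, 4 & fives a] ++ [:: 4; 5]).
Proof.
case: a => [|a]; first exact: (@seg_fan 4 5 4 1).
have -> : 4 :: fives a.+2 ++ [:: 4] = (4 :: fives a) ++ [:: 5; 5; 4].
  by rewrite /= fives_cat fives_cat.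
apply: (@seg_trans0 _ (4 :: fives a ++ [:: 6; 4; 4; 5])).
  exact: (@seg_pre (4 :: fives a) _ _ _ (@seg_fan 5 5 4 1)).
have := @seg_suf [:: 4; 5] _ _ _ (@seg_absorb a).
by rewrite /= -!catA.
Qed.

(** Every row shortens the side by one, until the two corners are adjacent. *)
Lemma seg_join a : seg (4 :: fives a ++ [:: 4]) [::] (fives a ++ [:: 4; 4] ++ fives a).
Proof.
elim: a => [|a IH]; first exact: seg_refl.
apply: seg_trans0 (seg_row a) _.
have := @seg_ctx [:: 5] [:: 5] _ _ _ IH.
by rewrite /= -!catA /= fives_cat cats0.
Qed.

(** The first of the two adjacent corners becomes the quadrangle. For [c > 0] this begins a row,
    which the far corner absorbs. *)
Lemma seg_quad c : seg (4 :: fives c ++ [:: 4; 4]) [:: 4] [:: 5, 4 & fives c.+1].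
Proof.
case: c => [|c]; first exact: (@seg_cover 4 [:: 4] 4 isT).
have -> : 4 :: fives c.+1 ++ [:: 4; 4] = (4 :: fives c) ++ [:: 5; 4; 4].
  by rewrite /= fives_cat.
apply: (@seg_trans_0 _ (4 :: fives c ++ [:: 6; 4; 5])).
  exact: (@seg_pre (4 :: fives c) _ _ _ (@seg_cover 5 [:: 4] 4 isT)).
have := @seg_suf [:: 5] _ _ _ (@seg_absorb c).
by rewrite /= -!catA /= fives_cat cats0.
Qed.

(** As in [seg_quad], but the finished corner is enlarged to a pentagon by one vertex cut, which
    leaves one more [4]. *)
Lemma seg_pent c : seg (4 :: fives c ++ [:: 4; 4]) [:: 5] ([:: 5, 4 & fives c] ++ [:: 4; 5]).
Proof.
case: c => [|c]; first exact: (@seg_fan 4 4 4 1).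
have -> : 4 :: fives c.+1 ++ [:: 4; 4] = (4 :: fives c) ++ [:: 5; 4; 4].
  by rewrite /= fives_cat.
apply: (@seg_trans_0 _ (4 :: fives c ++ [:: 6; 4; 4; 5])).
  exact: (@seg_pre (4 :: fives c) _ _ _ (@seg_fan 5 4 4 1)).
have := @seg_suf [:: 4; 5] _ _ _ (@seg_absorb c).
by rewrite /= -!catA.
Qed.

Lemma seg_big k : seg [:: 4; 4; 4] (non6 [:: k + 4]) (5 :: nseq k.+1 4 ++ [:: 5]).
Proof. by rewrite addnC; apply: seg_fan. Qed.

(** * Words of corners and straight facets; spending quadrangles and pentagons *)

Definition word45 (w : seq nat) : bool := all (fun d => (d == 4) || (d == 5)) w.

Lemma word45_cat u v : word45 (u ++ v) = word45 u && word45 v.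
Proof. exact: all_cat. Qed.

Lemma word45_fives a : word45 (fives a).
Proof. by apply/allP => d /nseqP[->]. Qed.

Lemma word45_fours a : word45 (nseq a 4).
Proof. by apply/allP => d /nseqP[->]. Qed.

Lemma count_fives a : count_mem 4 (fives a) = 0.
Proof. by rewrite count_nseq. Qed.

Lemma split_four w : word45 w -> 0 < count_mem 4 w -> exists a r,
  [/\ w = fives a ++ 4 :: r, word45 r & count_mem 4 w = (count_mem 4 r).+1].
Proof.
elim: w => //= d w IH /andP[/orP[/eqP->|/eqP->]] w45 /=.
  by move=> _; exists 0, w; rewrite add1n.
rewrite add0n => c0; have [a [r [-> r45 cr]]] := IH w45 c0.
by exists a.+1, r; split.
Qed.

Lemma no_four w : word45 w -> count_mem 4 w = 0 -> w = fives (size w).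
Proof.
elim: w => //= d w IH /andP[/orP[/eqP->|/eqP->]] w45 //= c0.
by rewrite -IH.
Qed.

(** The [5] is a place where the cyclic word can be opened; it supplies the nonempty rest that local
    moves require. *)
Definition state45 (s : nat) (w : seq nat) : Prop :=
  [/\ word45 w, count_mem 4 w = s, 5 \in w & 4 <= size w].

Lemma last_five s w : state45 s w -> exists u,
  [/\ steps w [::] (rcons u 5), word45 u & count_mem 4 u = s].
Proof.
case=> w45 cw w5 _.
case/splitPr: w5 w45 cw => u v; rewrite !word45_cat /= !count_cat /=.
move=> /andP[u45 v45] cw; exists (v ++ u); split.
- by apply: (@rotate_eq _ (u ++ [:: 5]) v); rewrite -?cats1 -?catA.
- by rewrite word45_cat u45 v45.
- by rewrite count_cat; lia.
Qed.

(** The word is opened at a [5], and the second and third corners are joined by [seg_join]; the new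
    fives only lengthen the neighbouring sides. *)
Lemma adjacent_fours s w : 2 < s -> state45 s w -> exists c r,
  [/\ steps w [::] ((4 :: fives c ++ [:: 4; 4]) ++ r), r != [::], word45 r &
      count_mem 4 r = s - 3].
Proof.
move=> s2 sw; have [u [st u45 cu]] := last_five sw.
have [|i [u1 [ui u1w cu1]]] := split_four u45; first by lia.
have [|a [u2 [ua u2w cu2]]] := split_four u1w; first by lia.
have [|b [r [ub rw cr]]] := split_four u2w; first by lia.
exists (a + b), (fives b ++ rcons r 5 ++ fives i); split.
- apply: (steps_trans0 st).
  apply: (@steps_trans0 _ ((fives i ++ 4 :: fives a) ++ (fives b ++ [:: 4; 4] ++ fives b)
                           ++ rcons r 5)).
    have -> : rcons u 5 = (fives i ++ 4 :: fives a) ++ (4 :: fives b ++ [:: 4]) ++ rcons r 5.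
      by rewrite ui ua ub; cats.
    by apply: seg_mid (@seg_join b) _; do ?apply: cat_nil_r; case: r {ub rw cr}.
  apply: (@rotate_eq _ (fives i) ((4 :: fives a) ++ (fives b ++ [:: 4; 4] ++ fives b)
                                  ++ rcons r 5)); first by cats.
  by rewrite fivesD; cats.
- by case: b r {ub rw cr} => // -[].
- by rewrite !word45_cat !word45_fives -cats1 word45_cat rw.
- by rewrite -cats1 !count_cat !count_fives -cu cu1 cu2 cr /=; lia.
Qed.

Lemma quad_step s w : 2 < s -> state45 s w -> exists2 w', state45 (s - 2) w' & steps w [:: 4] w'.
Proof.
move=> s2 sw; have [_ _ _ w4] := sw.
have [c [r [st r0 rw cr]]] := adjacent_fours s2 sw.
have {}st := steps_trans0 st (@seg_quad c r r0).
exists ([:: 5, 4 & fives c.+1] ++ r) => //; split => //.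
- by rewrite !word45_cat rw /= word45_fives.
- by rewrite count_cat cr /= count_fives; lia.
- exact: steps_size st w4.
Qed.

Lemma one_four w : state45 1 w -> exists2 m, 2 < m & steps w [::] (4 :: fives m).
Proof.
case=> w45 cw _ sw; have [|i [r [wi r45 cr]]] := split_four w45; first by lia.
have st : steps w [::] (4 :: fives (size r + i)).
  rewrite fivesD; apply: (@rotate_eq _ (fives i) (4 :: r)) => //.
  by rewrite /= -no_four //; lia.
exists (size r + i) => //.
by have := steps_size st sw; rewrite /= size_nseq.
Qed.

Lemma two_fours w : state45 2 w -> exists2 m, 1 < m & steps w [::] [:: 4, 4 & fives m].
Proof.
move=> sw; have [w45 cw w5 w4] := sw.
have [u [st u45 cu]] := last_five sw.
have [|i [u1 [ui u1w cu1]]] := split_four u45; first by lia.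
have [|a [r [ua rw cr]]] := split_four u1w; first by lia.
have r5 : r = fives (size r) by apply: no_four => //; lia.
have {}st : steps w [::] [:: 4, 4 & fives (a + (size r).+1 + i + a)].
  apply: (steps_trans0 st).
  apply: (@steps_trans0 _ (fives i ++ (fives a ++ [:: 4; 4] ++ fives a) ++ rcons r 5)).
    have -> : rcons u 5 = fives i ++ (4 :: fives a ++ [:: 4]) ++ rcons r 5.
      by rewrite ui ua; cats.
    by apply: seg_mid (@seg_join a) _; do ?apply: cat_nil_r; case: r {ua rw cr r5}.
  apply: (@rotate_eq _ (fives i ++ fives a) ([:: 4; 4] ++ fives a ++ rcons r 5)).
    by cats.
  by rewrite !fivesD fivesSr -r5; cats.
exists (a + (size r).+1 + i + a) => //.
by have := steps_size st w4; rewrite /= size_nseq.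
Qed.

(** Cyclic form of [seg_absorb]: the row runs across the leading fives and meets the last [4] of the
    word. *)
Lemma two_fours_absorb m r : 0 < m ->
  steps (fives m ++ [:: 6; 4] ++ r ++ [:: 4]) [::] ([:: 5, 4 & fives m.+1] ++ r).
Proof.
case: m => // m _; apply: (@steps_trans0 _ ([:: 6; 4] ++ fives m.+1 ++ r ++ [:: 4])).
  have := @seg_travel m.+1 (r ++ [:: 4]); rewrite -!catA; apply.
  exact: cat_nil_r.
apply: (@steps_trans0 _ ([:: 4; 6; 4] ++ fives m.+1 ++ r)).
  by apply: (@rotate_eq _ ([:: 6; 4] ++ fives m.+1 ++ r) [:: 4]); cats.
exact: (@cover 4 [:: 6] 4 (fives m.+1 ++ r)).
Qed.

(** For [j = 0] this spends a pentagon; for [j = 1] the finished facet is a hexagon, and the word is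
    lengthened at no cost. *)
Lemma two_fours_fan m j : 1 < m ->
  steps [:: 4, 4 & fives m] (non6 [:: 4 + j.+1]) ([:: 5, 4 & fives m.+1] ++ nseq j 4).
Proof.
case: m => [|[|m]] // _.
apply: (@steps_trans0 _ ([:: 5; 4; 4] ++ fives m.+1)).
  by apply: (@rotate_eq _ ([:: 4; 4] ++ fives m.+1) [:: 5]); cats; rewrite ?fives_cat ?cats0.
apply: steps_trans_0 (@fan 5 4 4 j.+1 (fives m.+1) _) _ => //.
apply: (@steps_trans0 _ (fives m.+2 ++ [:: 6; 4] ++ nseq j 4 ++ [:: 4])); last first.
  exact: two_fours_absorb.
apply: (@rotate_eq _ (6 :: nseq j.+2 4) (fives m.+2)); first by cats.
by cats; rewrite fours_cat cats0.
Qed.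

(** Only hexagons are finished. The increment is [3], in accordance with the invariant [hol] below,
    which depends on [m] modulo 3. *)
Lemma two_fours_grow m : 1 < m -> steps [:: 4, 4 & fives m] [::] [:: 4, 4 & fives (m + 3)].
Proof.
move=> m1; apply: steps_trans0 (@two_fours_fan m 1 m1) _.
apply: (@steps_trans0 _ ((4 :: fives 1 ++ [:: 4]) ++ fives m.+1)).
  by apply: (@rotate_eq _ ([:: 5; 4] ++ fives m.+1) [:: 4]); cats.
apply: steps_trans0 (@seg_row 0 (fives m.+1) _) _ => //.
apply: (@rotate_eq _ [:: 5] ([:: 4; 4; 5] ++ fives m.+1)); first by cats.
by rewrite addn3; cats; rewrite fives_cat cats0.
Qed.

Lemma two_fours_growth n m : 1 < m ->
  exists2 m', n < m' & steps [:: 4, 4 & fives m] [::] [:: 4, 4 & fives m'].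
Proof.
move=> m1; elim: n => [|n [m' nm st]]; first by exists m; [lia | exact: steps_refl].
have [le|lt] := ltnP n.+1 m'; first by exists m'.
case: m' nm lt st => [|[|m']] // nm lt st.
  exists m; last exact: steps_refl.
  lia.
exists (m'.+2 + 3); first lia.
exact: steps_trans0 st (two_fours_grow _).
Qed.

Lemma two_fours_pent m : 1 < m -> steps [:: 4, 4 & fives m] [:: 5] (4 :: fives m.+2).
Proof.
move=> m1; apply: steps_trans_0 (@two_fours_fan m 0 m1) _.
apply: (@rotate_eq _ [:: 5] ([:: 4] ++ fives m.+1)); first by rewrite cats0.
by cats; rewrite fives_cat cats0.
Qed.

(** The corners are used up: what remains is a tube with the end of a row, [6] and [4], in it. *)
Lemma two_fours_quad m : 1 < m -> steps [:: 4, 4 & fives m] [:: 4] [:: 6, 4 & fives m].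
Proof.
case: m => [|[|m]] // _.
apply: (@steps_trans0 _ ([:: 5; 4; 4] ++ fives m.+1)).
  by apply: (@rotate_eq _ ([:: 4; 4] ++ fives m.+1) [:: 5]); cats; rewrite ?fives_cat ?cats0.
exact: (@cover 5 [:: 4] 4 (fives m.+1)).
Qed.

Lemma state45_one m : 2 < m -> state45 1 (4 :: fives m).
Proof.
case: m => // m m2; split => //=; try by rewrite ?word45_fives ?count_fives.
by rewrite size_nseq.
Qed.

Lemma pent_step s w : 1 < s -> state45 s w -> exists2 w', state45 (s - 1) w' & steps w [:: 5] w'.
Proof.
move=> s1 sw; have [_ _ _ w4] := sw.
have [s2|s2] := leqP s 2.
  have s_eq : s = 2 by lia.
  rewrite s_eq in sw *; have [m m1 st] := two_fours sw.
  exists (4 :: fives m.+2); last exact: steps_trans0 st (two_fours_pent m1).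
  by apply: state45_one; lia.
have [c [r [st r0 rw cr]]] := adjacent_fours s2 sw.
have {}st := steps_trans0 st (@seg_pent c r r0).
exists (([:: 5, 4 & fives c] ++ [:: 4; 5]) ++ r) => //; split => //.
- by rewrite !word45_cat rw /= word45_fives.
- by rewrite !count_cat cr /= count_fives; lia.
- exact: steps_size st w4.
Qed.

Lemma quads_steps q s w : q.*2 < s -> state45 s w ->
  exists2 w', state45 (s - q.*2) w' & steps w (nseq q 4) w'.
Proof.
elim: q s w => [|q IH] s w qs sw.
  by exists w; [rewrite subn0 | exact: steps_refl].
have [|w1 sw1 st1] := quad_step _ sw; first by lia.
have [|w2 sw2 st2] := IH _ _ _ sw1; first by lia.
exists w2; first by have -> : s - q.+1.*2 = s - 2 - q.*2 by lia.
exact: steps_trans st1 st2.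
Qed.

Lemma pents_steps q s w : q < s -> state45 s w ->
  exists2 w', state45 (s - q) w' & steps w (nseq q 5) w'.
Proof.
elim: q s w => [|q IH] s w qs sw.
  by exists w; [rewrite subn0 | exact: steps_refl].
have [|w1 sw1 st1] := pent_step _ sw; first by lia.
have [|w2 sw2 st2] := IH _ _ _ sw1; first by lia.
exists w2; first by have -> : s - q.+1 = s - 1 - q by lia.
exact: steps_trans st1 st2.
Qed.

(** The row begun by the fan runs round all the fives until its [6] meets the one at the other end
    of the fan, and a single chord covers both. The uses are [i = 0] for a pentagon, [i = 1] for
    free growth, and [i = k - 5] for a large odd facet. *)
Lemma one_four_fan i m : 2 < m ->
  steps (4 :: fives m) (non6 [:: 5 + i]) (nseq i 4 ++ fives m.+1).
Proof.
case: m => [|[|[|m]]] // _.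
apply: (@steps_trans0 _ ([:: 5; 4; 5] ++ fives m.+1)).
  by apply: (@rotate_eq _ ([:: 4; 5] ++ fives m.+1) [:: 5]); cats; rewrite ?fives_cat ?cats0.
rewrite -[5 + i]/(4 + i.+1).
apply: steps_trans_0 (@fan 5 4 5 i.+1 (fives m.+1) _) _ => //.
apply: (@steps_trans0 _ ((fives m.+1 ++ [:: 6; 4]) ++ nseq i 4 ++ [:: 4; 6])).
  apply: (@rotate_eq _ (6 :: nseq i.+2 4 ++ [:: 6]) (fives m.+1)); first by cats.
  by cats; rewrite fours_cat.
apply: steps_trans0 (@seg_travel m.+1 _ _) _; first exact: cat_nil_r.
apply: (@steps_trans0 _ ((4 :: [:: 6; 6] ++ [:: 4]) ++ fives m.+1 ++ nseq i 4)).
  by apply: (@rotate_eq _ ([:: 6; 4] ++ fives m.+1 ++ nseq i 4) [:: 4; 6]); cats.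
apply: steps_trans0 (@seg_cover 4 [:: 6; 6] 4 isT _ _) _ => //.
by apply: (@rotate_eq _ ([:: 5; 5; 5] ++ fives m.+1) (nseq i 4)); cats.
Qed.

(** With a single corner the length grows by [1] rather than [3]; this is what allows any residue
    modulo 3 to be reached before an odd facet is finished. *)
Lemma one_four_grow m : 2 < m -> steps (4 :: fives m) [::] (4 :: fives m.+1).
Proof. exact: (@one_four_fan 1). Qed.

Lemma one_four_growth m n : 2 < m -> m <= n -> steps (4 :: fives m) [::] (4 :: fives n).
Proof.
move=> m2; elim: n => [|n IH]; first by lia.
rewrite leq_eqVlt => /orP[/eqP->|mn]; first exact: steps_refl.
by apply: steps_trans0 (IH _) (one_four_grow _); lia.
Qed.

(** Three consecutive corners are consumed and [k - 3 > 3] consecutive ones are created, so the next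
    large facet finds its three corners again. *)
Lemma bigs_steps K s w : all (fun k => 6 < k) K -> state45 s w -> 2 < s ->
  (exists2 r, w = [:: 4; 4; 4] ++ r & r != [::]) ->
  exists2 w', state45 (s + \sum_(k <- K) (k - 6)) w' & steps w K w'.
Proof.
elim: K s w => [|k K IH] s w /=.
  by move=> _ sw _ _; exists w; [rewrite big_nil addn0 | exact: steps_refl].
case/andP=> k6 K6 sw s2 [r w_eq r0].
have [w45 cw w5 w4] := sw.
have st1 : steps w [:: k] ((5 :: nseq (k - 4).+1 4 ++ [:: 5]) ++ r).
  have := @seg_big (k - 4) r r0; rewrite subnK; last by lia.
  by rewrite w_eq /non6 /= ifT //; lia.
pose r' := nseq (k - 6) 4 ++ 5 :: r ++ [:: 5].
have st2 : steps w [:: k] ([:: 4; 4; 4] ++ r').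
  apply: steps_trans_0 st1 _.
  apply: (@rotate_eq _ [:: 5] (nseq (k - 4).+1 4 ++ [:: 5] ++ r)); first by cats.
  by rewrite /r' (_ : (k - 4).+1 = 3 + (k - 6)); [cats | lia].
have sw' : state45 (s + (k - 6)) ([:: 4; 4; 4] ++ r').
  split.
  - move: w45; rewrite w_eq /r' !word45_cat /= word45_fours /= => r45.
    by rewrite word45_cat r45.
  - move: cw; rewrite w_eq /r' !count_cat /= !count_cat count_nseq /=; lia.
  - by rewrite /r' !mem_cat mem_head !orbT.
  - exact: steps_size st2 w4.
have [||w3 sw3 st3] := IH _ _ K6 sw'; first by lia.
  by exists r' => //; apply: cat_nil_r.
exists w3; first by rewrite big_cons addnA.
exact: steps_trans st2 st3.
Qed.

(** * Monodromy of 3-colourings *)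

Inductive color := Red | Green | Blue.

Definition shift c := match c with Red => Green | Green => Blue | Blue => Red end.

Definition flip c := match c with Red => Red | Green => Blue | Blue => Green end.

(** Change of frame from the colours of the previous and current facets to those of the current and
    next ones. Around a facet of size [d] the neighbours other than the outer facet alternate
    between two colours, so the frame changes by a transposition if [d] is even and by a 3-cycle if
    [d] is odd. *)
Definition act (d : nat) (c : color) : color := shift (if odd d then c else flip c).

(* If all finished facets are even, all facets but the outer one admit a proper 3-colouring;
   [hol] is its monodromy along the boundary word. *)
Definition hol (w : seq nat) (c : color) : color := foldr act c w.

Definition hol_trivial (w : seq nat) : Prop := forall c, hol w c = c.

Lemma hol_cat u v c : hol (u ++ v) c = hol u (hol v c).
Proof. exact: foldr_cat. Qed.

Lemma act_inj d : injective (act d).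
Proof. by rewrite /act; case: odd; do 2!case. Qed.

Lemma hol_inj w : injective (hol w).
Proof. by elim: w => //= d w IH c c' /act_inj/IH. Qed.

Lemma hol_trivial_rot u v : hol_trivial (u ++ v) -> hol_trivial (v ++ u).
Proof. by move=> h c; apply: (@hol_inj u); rewrite -[LHS]hol_cat catA hol_cat h. Qed.

Lemma hol_even M c : all (predC odd) M -> hol M c = if odd (size M) then act 4 c else c.
Proof.
elim: M => //= d M IH /andP[d0 /IH->].
by rewrite /act (negbTE d0); case: odd {IH}; case: c.
Qed.

Lemma hol_fours j c : hol (nseq j 4) c = if odd j then act 4 c else c.
Proof. by rewrite hol_even ?size_nseq //; apply/allP => d /nseqP[->]. Qed.

Lemma even_non6 M : all (predC odd) (non6 M) -> all (predC odd) M.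
Proof.
move=> /allP h; apply/allP => d dM; have [->//|d6] := eqVneq d 6.
by apply: h; rewrite mem_filter d6.
Qed.

(** Across even facets the old and the new stretch of the word act by the same permutation of
    colours; this depends on parities only, which leaves a finite check. *)
Lemma hol_steps w E w' : steps w E w' -> all (predC odd) E -> hol_trivial w -> hol_trivial w'.
Proof.
move=> st + hw; elim: st => {E w'} //.
- by move=> E E' w' _ IH pE; rewrite -(perm_all _ pE).
- by move=> E u v _ IH /IH; apply: hol_trivial_rot.
- move=> E x M y r _ IH _ _; rewrite all_cat => /andP[/even_non6 M0 /IH h] c.
  rewrite -{2}(h c) /= hol_cat /= (@hol_even M _ M0).
  case: (hol r c) => {h}; rewrite /act /= oddD /=;
  by case: (odd x); case: (odd y); case: (odd (size M)).
- move=> E x z y j r _ IH _; rewrite all_cat => /andP[/even_non6 /= /andP[+ _] /IH h] c.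
  rewrite -{2}(h c) /= hol_cat /= hol_fours oddD.
  case: (hol r c) => {h}; rewrite /act /=;
  by case: (odd x); case: (odd y); case: (odd z); case: (odd j).
Qed.

Lemma iter_shift q c : iter (q * 3) shift c = c.
Proof. by elim: q => // q; rewrite mulSn iterD => ->; case: c. Qed.

Lemma hol_fives m c : hol (fives m) c = iter m shift c.
Proof. by elim: m => //= m ->. Qed.

Lemma iter_shift_id m c : iter m shift c = c -> 3 %| m.
Proof.
rewrite {1}(divn_eq m 3) addnC iterD iter_shift => h.
rewrite /dvdn; case: (m %% 3) (ltn_pmod m (isT : 0 < 3)) h => [|[|[|]]] //=.
  by case: c.
by case: c.
Qed.

(** * Closing the tube *)

(** At the end the outer facet and the facets around it count as well, hence [size w' :: w']. *)
Definition closes (w E : seq nat) : Prop :=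
  exists w' E', steps w E' w' /\ perm_eq (non6 (size w' :: w') ++ E') E.

Lemma closes_steps w E1 w1 E2 E :
  steps w E1 w1 -> closes w1 E2 -> perm_eq (E1 ++ E2) E -> closes w E.
Proof.
move=> s1 [w' [E' [s2 p2]]] p; exists w', (E1 ++ E'); split.
  exact: steps_trans s1 s2.
by rewrite perm_catCA (perm_trans _ p) // perm_cat2l.
Qed.

Lemma closes_steps0 w w1 E : steps w [::] w1 -> closes w1 E -> closes w E.
Proof. by move=> s1 c1; apply: closes_steps s1 c1 _. Qed.

(** A row around the whole tube is completed: the pair [6], [4] goes once round, and its [6] is
    covered together with the other one. *)
Lemma hook a : 1 < a -> steps [:: 6, 4, 6 & fives a] [::] (6 :: fives a.+1).
Proof.
case: a => [|[|a]] // _.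
apply: (@steps_trans0 _ ((fives a.+2 ++ [:: 6; 4]) ++ [:: 6])).
  by apply: (@rotate_eq _ [:: 6; 4; 6] (fives a.+2)); cats.
apply: steps_trans0 (@seg_travel a.+2 [:: 6] _) _ => //.
apply: (@steps_trans0 _ ((5 :: [:: 6; 6] ++ [:: 4]) ++ fives a.+1)).
  apply: (@rotate_eq _ ([:: 6; 4] ++ fives a.+1) [:: 5; 6]); first by cats; rewrite fives_cat.
  by cats.
exact: (@seg_cover 5 [:: 6; 6] 4 isT).
Qed.

(** Each turn around the tube shortens the word by one. The end is an outer pentagon surrounded by
    four pentagons and a hexagon. *)
Lemma closes_six n : 3 < n -> closes (6 :: fives n) (nseq 5 5).
Proof.
elim: n => // n IH; rewrite ltnS leq_eqVlt => /orP[/eqP<-|n3].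
  by exists (6 :: fives 4), [::]; split; [exact: steps_refl|].
apply: closes_steps0 (IH n3).
case: n n3 {IH} => [|[|n]] // n3.
apply: (@steps_trans0 _ ((5 :: [:: 6] ++ [:: 5]) ++ fives n.+1)).
  apply: (@rotate_eq _ (6 :: fives n.+2) [:: 5]); first by cats; rewrite fives_cat cats0.
  by cats.
apply: steps_trans0 (@seg_cover 5 [:: 6] 5 isT _ _) _ => //.
by apply: hook; lia.
Qed.

Lemma closes_six_four m : 3 < m -> closes [:: 6, 4 & fives m] (nseq 6 5).
Proof.
move=> m3; apply: (@closes_steps _ [:: 5] _ (nseq 5 5)) (closes_six m3) _ => //.
case: m m3 => [|[|[|m]]] // _.
apply: (@steps_trans0 _ ((5 :: [:: 5; 6] ++ [:: 4]) ++ fives m.+1)).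
  apply: (@rotate_eq _ ([:: 6; 4] ++ fives m.+1) [:: 5; 5]); last by cats.
  by cats; rewrite !fives_cat cats0.
exact: (@seg_cover 5 [:: 5; 6] 4 isT).
Qed.

Lemma closes_fives m : 5 < m -> closes (fives m) (nseq 6 5).
Proof.
case: m => [|[|[|m]]] // m2.
apply: (@closes_steps _ [:: 5] (6 :: fives m.+1) (nseq 5 5)) => //.
  apply: steps_trans_0 (@hook m _); last by lia.
  by apply: (@cover 5 [:: 5] 5 (fives m)) => //; case: m m2.
by apply: closes_six; lia.
Qed.

(** Two sixes separated by sides of lengths [a] and [b]. The moves below replace these by [a + 1]
    and [b - 2], so [a - b] modulo 3 is preserved; the cap of two quadrangles is reached when it
    vanishes. *)
Definition two_six (a b : nat) : seq nat := 6 :: fives a ++ 6 :: fives b.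

Lemma two_six_step a b : 0 < a -> 1 < b -> steps (two_six a b) [::] (two_six a.+1 (b - 2)).
Proof.
case: a b => [|a] [|[|b]] // _ _; rewrite subn2.
apply: (@steps_trans0 _ ((6 :: fives a) ++ [:: 6; 4; 6] ++ fives b.+1)).
  have -> : two_six a.+1 b.+2 = (6 :: fives a) ++ [:: 5; 6; 5] ++ fives b.+1.
    by rewrite /two_six; cats; rewrite fives_cat.
  exact: seg_mid (@seg_cover 5 [:: 6] 5 isT) _.
apply: (@steps_trans0 _ ([:: 6] ++ ([:: 6; 4] ++ fives a) ++ 6 :: fives b.+1)).
  have := @seg_mid [:: 6] (6 :: fives b.+1) _ _ _ (@seg_travel a) isT.
  by rewrite -!catA.
apply: (@steps_trans0 _ ((5 :: [:: 6; 6] ++ [:: 4]) ++ fives a ++ 6 :: fives b)).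
  apply: (@rotate_eq _ ([:: 6; 6; 4] ++ fives a ++ 6 :: fives b) [:: 5]); last by cats.
  by cats; rewrite fives_cat cats0.
by apply: (@seg_cover 5 [:: 6; 6] 4 isT); case: a.
Qed.

Lemma two_six_step0 b : 2 < b -> steps (two_six 0 b) [::] (two_six 1 (b - 2)).
Proof.
case: b => [|[|[|b]]] // _.
apply: (@steps_trans0 _ ((5 :: [:: 6; 6] ++ [:: 5]) ++ fives b.+1)).
  apply: (@rotate_eq _ ([:: 6; 6] ++ fives b.+2) [:: 5]); last by cats.
  by rewrite /two_six; cats; rewrite fives_cat cats0.
exact: (@seg_cover 5 [:: 6; 6] 5 isT).
Qed.

(** Descent on [a + b], always shortening the longer side. Equal sides can still be stepped unless
    both are [1]; then one more chord leaves an outer quadrangle next to another one. *)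
Lemma closes_two_six a b : a = b %[mod 3] -> 0 < a + b -> closes (two_six a b) [:: 4; 4].
Proof.
have [n] := ubnP (a + b); elim: n a b => // n IH a b abn ab ab0.
wlog leab : a b abn ab ab0 / a <= b => [hw|].
  have [|/ltnW] := leqP a b; first exact: hw.
  move=> /(hw b a) h; apply: closes_steps0 (h _ _ _); rewrite ?(addnC b) //.
  by apply: (@rotate_eq _ (6 :: fives a) (6 :: fives b)).
have [eab|neab] := eqVneq a b.
  rewrite -eab in leab ab abn ab0 *; case: a ab0 abn {ab eab leab} => [|[|a]] // _ abn.
    exists [:: 6; 4; 6; 6], [::]; split => //.
    apply: (@steps_trans0 _ ((5 :: [:: 6] ++ [:: 5]) ++ [:: 6])).
      exact: (@rotate_eq _ [:: 6; 5; 6] [:: 5]).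
    exact: (@seg_cover 5 [:: 6] 5 isT).
  apply: closes_steps0 (two_six_step _ _) (IH _ _ _ _ _) => //; try lia.
have ab3 : a + 3 <= b.
  move: ab neab; rewrite (divn_eq a 3) (divn_eq b 3) !modnMDl !modn_mod => -> ; lia.
case: a ab3 abn ab {ab0 leab neab} => [|a] ab3 abn ab.
  apply: closes_steps0 (two_six_step0 _) (IH _ _ _ _ _) => //; try lia.
apply: closes_steps0 (two_six_step _ _) (IH _ _ _ _ _) => //; try lia.
Qed.

(** The first quadrangle turns the tube into two sixes at distances [3] and [m - 3], which are
    congruent because 3 divides [m]. *)
Lemma closes_six_four4 m : 2 < m -> 3 %| m -> closes [:: 6, 4 & fives m] (nseq 3 4).
Proof.
move=> m2 m3; apply: (@closes_steps _ [:: 4] (two_six 3 (m - 3)) [:: 4; 4]) => //; last first.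
  by apply: closes_two_six => //; lia.
case: m m2 {m3} => [|[|[|m]]] // _; rewrite !subSS subn0.
apply: (@steps_trans0 _ ([:: 6] ++ [:: 5; 4; 4; 6] ++ fives m.+1)).
  exact: (@seg_mid [:: 6] (fives m.+1) _ _ _ (@seg_fan 4 5 5 1)).
apply: (@steps_trans_0 _ ([:: 6] ++ [:: 6; 4; 5] ++ 6 :: fives m.+1)).
  exact: (@seg_mid [:: 6] (6 :: fives m.+1) _ _ _ (@seg_cover 5 [:: 4] 4 isT)).
apply: (@steps_trans0 _ ((5 :: [:: 6; 6] ++ [:: 4]) ++ [:: 5; 6] ++ fives m)).
  apply: (@rotate_eq _ ([:: 6; 6; 4; 5; 6] ++ fives m) [:: 5]); last by cats.
  by cats; rewrite fives_cat cats0.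
exact: (@seg_cover 5 [:: 6; 6] 4 isT).
Qed.

(** The same plan with distances [4] and [m - 5]. *)
Lemma closes_fives4 m : 8 < m -> 3 %| m -> closes (fives m) (nseq 3 4).
Proof.
move=> m2 m3; apply: (@closes_steps _ [:: 4] (two_six 4 (m - 5)) [:: 4; 4]) => //; last first.
  by apply: closes_two_six => //; lia.
case: m m2 {m3} => [|[|[|[|[|m]]]]] // m3; rewrite !subSS subn0.
apply: (@steps_trans0 _ ([:: 6; 4; 4; 6] ++ fives m.+2)).
  exact: (@seg_fan 5 5 5 1 (fives m.+2)).
apply: (@steps_trans0 _ ([:: 6] ++ [:: 4; 5; 4] ++ 6 :: fives m.+1)).
  apply: (@steps_trans0 _ ((5 :: [:: 6] ++ [:: 4]) ++ [:: 4; 6] ++ fives m.+1)).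
    apply: (@rotate_eq _ ([:: 6; 4; 4; 6] ++ fives m.+1) [:: 5]); last by cats.
    by cats; rewrite fives_cat cats0.
  exact: (@seg_cover 5 [:: 6] 4 isT).
apply: (@steps_trans0 _ ([:: 6] ++ [:: 5; 4; 4; 5] ++ 6 :: fives m.+1)).
  exact: (@seg_mid [:: 6] (6 :: fives m.+1) _ _ _ (@seg_fan 4 5 4 1)).
apply: (@steps_trans_0 _ ([:: 6] ++ [:: 6; 4; 5] ++ [:: 5; 6] ++ fives m.+1)).
  exact: (@seg_mid [:: 6] ([:: 5; 6] ++ fives m.+1) _ _ _ (@seg_cover 5 [:: 4] 4 isT)).
apply: (@steps_trans0 _ ((5 :: [:: 6; 6] ++ [:: 4]) ++ [:: 5; 5; 6] ++ fives m)).
  apply: (@rotate_eq _ ([:: 6; 6; 4; 5; 5; 6] ++ fives m) [:: 5]); last by cats.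
  by cats; rewrite fives_cat cats0.
exact: (@seg_cover 5 [:: 6; 6] 4 isT).
Qed.

Lemma closes_two_fours m : 1 < m -> closes [:: 4, 4 & fives m] (4 :: nseq 6 5).
Proof.
move=> m1; have [m' m3 st] := two_fours_growth 3 m1; apply: (closes_steps0 st).
apply: (@closes_steps _ [:: 4] _ (nseq 6 5)) (closes_six_four m3) _ => //.
by apply: two_fours_quad; lia.
Qed.

Lemma closes_two_fours4 m : 1 < m -> hol_trivial [:: 4, 4 & fives m] ->
  closes [:: 4, 4 & fives m] (nseq 4 4).
Proof.
move=> m1 hm; have [m' m3 st] := two_fours_growth 3 m1; apply: (closes_steps0 st).
apply: (@closes_steps _ [:: 4] [:: 6, 4 & fives m'] (nseq 3 4)) => //.
  by apply: two_fours_quad; lia.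
apply: closes_six_four4; first by lia.
(* The transpositions of the two fours cancel, so the 3-cycles of the [m'] fives must compose to the
   identity. *)
have := hol_steps st isT hm Red; rewrite /= hol_fives => h.
by apply: (@iter_shift_id m' Red); move: h; case: (iter m' shift Red).
Qed.

Lemma closes_one_four m : 2 < m -> closes (4 :: fives m) (nseq 7 5).
Proof.
move=> m2; apply: closes_steps0 (one_four_growth m2 (leq_addr 4 m)) _.
apply: (@closes_steps _ [:: 5] (fives (m + 4).+1) (nseq 6 5)) => //.
  by apply: (@one_four_fan 0); lia.
by apply: closes_fives; lia.
Qed.

Lemma closes_one_four4 m : 2 < m -> closes (4 :: fives m) (5 :: nseq 3 4).
Proof.
(* The pentagon adds one [5]: [3 * m + 8] becomes [3 * m + 9], a multiple of 3 exceeding 8. *)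
move=> m2; apply: closes_steps0 (one_four_growth m2 (_ : m <= 3 * m + 8)) _; first by lia.
apply: (@closes_steps _ [:: 5] (fives (3 * m + 8).+1) (nseq 3 4)) => //.
  by apply: (@one_four_fan 0); lia.
by apply: closes_fives4; lia.
Qed.

(** The odd facet is finished when a single corner is left, so that the length can be tuned first.
    Afterwards there are an even number [k - 5] of fours and a multiple of 3 of fives, hence trivial
    monodromy, and only even facets follow. The number [q] of quadrangles leaves two corners. *)
Lemma closes_one_four_odd m k : 2 < m -> 6 < k -> odd k ->
  closes (4 :: fives m) (k :: nseq ((k - 5)./2 + 3) 4).
Proof.
move=> m2 k6 ok; pose M := 3 * m + 8.
apply: closes_steps0 (one_four_growth m2 (_ : m <= M)) _; first by rewrite /M; lia.
have st1 : steps (4 :: fives M) [:: k] (nseq (k - 5) 4 ++ fives M.+1).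
  have := @one_four_fan (k - 5) M _; rewrite subnKC; last by lia.
  by rewrite /non6 /= ifT; [apply; rewrite /M; lia | lia].
pose q := ((k - 5)./2).-1.
have s1 : state45 (k - 5) (nseq (k - 5) 4 ++ fives M.+1).
  split.
  - by rewrite word45_cat word45_fours word45_fives.
  - by rewrite count_cat count_fives count_nseq /= mul1n addn0.
  - by rewrite mem_cat /= mem_head orbT.
  - by rewrite size_cat !size_nseq /M; lia.
have [|w sw st2] := @quads_steps q _ _ _ s1; first by rewrite /q; lia.
have e2 : k - 5 - q.*2 = 2 by rewrite /q; lia.
rewrite e2 in sw; have [M' M1 st3] := two_fours sw.
apply: (@closes_steps _ ([:: k] ++ nseq q 4) [:: 4, 4 & fives M'] (nseq 4 4)).
- exact: steps_trans st1 (steps_trans_0 st2 st3).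
- apply: closes_two_fours4 => //.
  apply: (hol_steps (steps_trans_0 st2 st3)); first by apply/allP => d /nseqP[->].
  move=> c; rewrite hol_cat hol_fours hol_fives ifF; last by lia.
  by rewrite (_ : M.+1 = (m + 3) * 3) ?iter_shift // /M; lia.
- by rewrite -catA -nseqD (_ : q + 4 = (k - 5)./2 + 3) // /q; lia.
Qed.

(** The bare prism has no [5]; finishing one quadrangle as a hexagon creates two of them and keeps
    three adjacent fours. *)
Lemma prism_start n : n = 4 \/ n = 5 -> exists w, [/\ steps (nseq n 4) [::] w, state45 n w &
  exists2 r, w = [:: 4; 4; 4] ++ r & r != [::]].
Proof.
case=> ->.
- exists [:: 4; 4; 4; 5; 4; 5]; split => //; last by exists [:: 5; 4; 5].
  apply: steps_trans0 (@seg_fan 4 4 4 2 [:: 4] isT) _.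
  exact: (@rotate_eq _ [:: 5] [:: 4; 4; 4; 5; 4]).
- exists [:: 4; 4; 4; 5; 4; 4; 5]; split => //; last by exists [:: 5; 4; 4; 5].
  apply: steps_trans0 (@seg_fan 4 4 4 2 [:: 4; 4] isT) _.
  exact: (@rotate_eq _ [:: 5] [:: 4; 4; 4; 5; 4; 4]).
Qed.

(** * Distributing the prescribed facets *)

Definition excess (K : seq nat) : nat := \sum_(k <- K) (k - 6).

Lemma opening n K q r : n = 4 \/ n = 5 -> all (fun k => 6 < k) K ->
  q.*2 + r < n + excess K -> exists2 w, state45 (n + excess K - (q.*2 + r)) w &
    steps (nseq n 4) (K ++ nseq q 4 ++ nseq r 5) w.
Proof.
move=> n45 K6 qr; have [w0 [st0 s0 w0r]] := prism_start n45.
have [|w1 s1 st1] := bigs_steps K6 s0 _ w0r; first by case: n45 => ->.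
have [|w2 s2 st2] := @quads_steps q _ _ _ s1; first by rewrite -/(excess K); lia.
have [|w3 s3 st3] := @pents_steps r _ _ _ s2; first by rewrite -/(excess K); lia.
exists w3; first by rewrite subnDA.
exact: steps_trans0 st0 (steps_trans st1 (steps_trans st2 st3)).
Qed.

Lemma perm_count45 (s t : seq nat) : (forall d, count_mem d s = count_mem d t) -> perm_eq s t.
Proof. by move=> h; apply/allP => d _ /=; rewrite h. Qed.

Lemma odd_excess K : all (predC odd) K -> all (fun k => 6 < k) K -> ~~ odd (excess K).
Proof.
rewrite /excess; elim: K => [|k K IH] /=; first by rewrite big_nil.
by move=> /andP[k0 /IH{}IH] /andP[k6 /IH h]; rewrite big_cons oddD oddB /=; lia.
Qed.

(** The number of pentagons decides which start and which cap are affordable. Their facets are held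
    back, all others are spent by [opening], and the balance leaves the one or two corners from
    which the cap is built. *)
Theorem game_closes p4 p5 K : all (fun k => 6 < k) K ->
  p4.*2 + p5 = 12 + excess K ->
  exists n E, [/\ n = 4 \/ n = 5, closes (nseq n 4) E &
    perm_eq (n :: E) (nseq p4 4 ++ nseq p5 5 ++ K)].
Proof.
move=> K6 e; set goal := _ ++ _.
have fin n E1 w E2 : n = 4 \/ n = 5 -> steps (nseq n 4) E1 w -> closes w E2 ->
    perm_eq (n :: E1 ++ E2) goal -> exists n E, [/\ n = 4 \/ n = 5, closes (nseq n 4) E &
    perm_eq (n :: E) goal].
  move=> n45 st cl pe; exists n, (E1 ++ E2); split => //.
  exact: closes_steps st cl _.
have cnt E : (forall d, count_mem d E = p4 * (4 == d) + p5 * (5 == d) + count_mem d K) ->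
    perm_eq E goal.
  move=> h; apply: perm_count45 => d.
  by rewrite h /goal !count_cat !count_nseq /=; lia.
(* Held back: the initial pentagon and the seven of [closes_one_four]. *)
have [p5_7|p5_7] := ltnP 7 p5.
  have [||w sw st] := @opening 5 K p4 (p5 - 8) _ K6; [by right | by lia |].
  rewrite (_ : _ - _ = 1) in sw; last by lia.
  have [m m2 st1] := one_four sw.
  apply: (fin 5 _ _ _ _ (steps_trans_0 st st1) (closes_one_four m2)); first by right.
  by apply: cnt => d; rewrite /= !count_cat !count_nseq /=; lia.
have [p5_6|p5_6] := ltnP 6 p5.
  have [||w sw st] := @opening 5 K (p4 - 1) 0 _ K6; [by right | by lia |].
  rewrite (_ : _ - _ = 2) in sw; last by lia.
  have [m m2 st1] := two_fours sw.
  apply: (fin 5 _ _ _ _ (steps_trans_0 st st1) (closes_two_fours m2)); first by right.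
  by apply: cnt => d; rewrite /= !count_cat !count_nseq /=; lia.
have [p5_5|p5_5] := ltnP 5 p5.
  have [||w sw st] := @opening 4 K (p4 - 2) 0 _ K6; [by left | by lia |].
  rewrite (_ : _ - _ = 2) in sw; last by lia.
  have [m m2 st1] := two_fours sw.
  apply: (fin 4 _ _ _ _ (steps_trans_0 st st1) (closes_two_fours m2)); first by left.
  by apply: cnt => d; rewrite /= !count_cat !count_nseq /=; lia.
have [p5_0|p5_0] := ltnP 0 p5.
  have [||w sw st] := @opening 4 K (p4 - 4) (p5 - 1) _ K6; [by left | by lia |].
  rewrite (_ : _ - _ = 1) in sw; last by lia.
  have [m m2 st1] := one_four sw.
  apply: (fin 4 _ _ _ _ (steps_trans_0 st st1) (closes_one_four4 m2)); first by left.
  by apply: cnt => d; rewrite /= !count_cat !count_nseq /=; lia.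
(* Without odd facets the monodromy of the initial word, four fours, is trivial and stays so; this
   supplies the length condition of the cap. *)
have [evK|] := boolP (all (predC odd) K).
  have ev := odd_excess evK K6.
  have [||w sw st] := @opening 4 K (p4 - 5) 0 _ K6; [by left | by lia |].
  rewrite (_ : _ - _ = 2) in sw; last by lia.
  have [m m2 st1] := two_fours sw.
  have st2 := steps_trans_0 st st1.
  apply: (fin 4 _ _ _ _ st2 (closes_two_fours4 m2 _)); first by left.
    apply: (hol_steps st2); last by case.
    by rewrite !all_cat evK /= andbT; apply/allP => d /nseqP[->].
  by apply: cnt => d; rewrite /= !count_cat !count_nseq /=; lia.
(* No pentagon but an odd large facet [k], which is held back for the cap. The equation makes
   [excess K] even while [k - 6] is odd, so [excess (rem k K)] is odd and [q] quadrangles leave one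
   corner. *)
rewrite -has_predC => /hasP[k kK /=]; rewrite negbK => ok.
have pK := perm_to_rem kK.
have exK : excess K = (k - 6) + excess (rem k K).
  by rewrite /excess (perm_big _ pK) big_cons.
have K6' : all (fun k => 6 < k) (rem k K) by apply/allP => d /mem_rem /(allP K6).
have k6 : 6 < k := allP K6 _ kK.
have [q qE] : exists q, q.*2 = 3 + excess (rem k K).
  by exists ((3 + excess (rem k K))./2); lia.
have [||w sw st] := @opening 4 (rem k K) q 0 _ K6'; [by left | by lia |].
rewrite (_ : _ - _ = 1) in sw; last by lia.
have [m m2 st1] := one_four sw.
apply: (fin 4 _ _ _ _ (steps_trans_0 st st1) (closes_one_four_odd m2 k6 ok)); first by left.
have ck d : count_mem d K = (k == d) + count_mem d (rem k K) by rewrite (permP pK).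
by apply: cnt => d; rewrite /= !count_cat /= !count_nseq ck /=; case: (4 == d); case: (5 == d); lia.
Qed.

(** * Cutting a face by a chord: incidences and flagness *)

Lemma some_eq (T : eqType) (a b : T) : (Some a == Some b) = (a == b).
Proof. by []. Qed.

(** * Simple incidence structures and weakened flagness *)

Section Incidence.
Variables (V F : finType) (inc : V -> F -> bool).

(** In [simple_edge], [w] is the other end of the edge of [f] and [g] at [v]; the facet [h]
    witnesses that [w] differs from [v]. *)
Record simple_inc : Prop := SimpleInc {
  simple_three : forall v, exists p q r, uniq [:: p; q; r] /\
    forall f, inc v f = (f \in [:: p; q; r]);
  simple_edge : forall v f g, f != g -> inc v f -> inc v g ->
    exists w h, [/\ inc w f, inc w g, inc v h & ~~ inc w h];
  simple_facet : forall f, exists v, inc v f;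
  simple_inj : forall u v, (forall f, inc u f -> inc v f) -> u = v }.

Definition fsize (f : F) : nat := \sum_v inc v f.

Definition pairwise_meet (S : {set F}) : Prop :=
  forall f g, f \in S -> g \in S -> exists v, inc v f && inc v g.

Definition common (S : {set F}) : Prop := exists v, forall f, f \in S -> inc v f.

(** A triangle cut off at an end of the side [z] of [F0] is encircled by three pairwise meeting
    facets without a common vertex, two of which are [F0] and [z]; sets containing both are
    exempted. *)
Definition flag_but (F0 : F) (Z : option F) : Prop := forall S, pairwise_meet S ->
  common S \/ (if Z is Some z then F0 \in S /\ z \in S else False).

Lemma three_other v F0 : simple_inc -> inc v F0 -> exists p q,
  uniq [:: F0; p; q] /\ forall f, inc v f = (f \in [:: F0; p; q]).
Proof.
move=> /simple_three/(_ v)[p [q [r [u h]]]]; rewrite h !inE => /or3P[] /eqP e.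
- by rewrite e; exists q, r.
- exists p, r; rewrite e; split=> [|f]; last by rewrite h !inE orbCA.
  by move: u; rewrite /= !inE !negb_or (eq_sym q p) -!andbA => /and4P[-> -> ->].
- exists p, q; rewrite e; split=> [|f]; last by rewrite h !inE orbC -orbA orbC -orbA orbCA.
  by move: u; rewrite /= !inE !negb_or (eq_sym r) (eq_sym r) -!andbA => /and4P[-> -> ->].
Qed.

(** In an entry [(v, g)], [v] is the vertex of [F0] between the preceding facet and [g]; the initial
    [p] is the facet before the first entry. *)
Fixpoint ring (F0 p : F) (l : seq (V * F)) : Prop :=
  if l is (v, g) :: l' then (forall f, inc v f = (f \in [:: F0; p; g])) /\ ring F0 g l'
  else True.

Lemma ring_cat F0 p l l' :
  ring F0 p (l ++ l') <-> ring F0 p l /\ ring F0 (last p (map snd l)) l'.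
Proof. by elim: l p => [|[v g] l IH] p /=; [|rewrite IH]; tauto. Qed.

Lemma ring_mem F0 p l v f : ring F0 p l -> v \in map fst l -> inc v f ->
  f \in F0 :: p :: map snd l.
Proof.
elim: l p => [|[u g] l IH] p //= [hu hl]; rewrite inE => /orP[/eqP->|vl].
  by rewrite hu !inE => /or3P[]->; rewrite ?orbT.
by move=> /(IH _ hl vl); rewrite !inE => /or3P[]->; rewrite ?orbT.
Qed.

End Incidence.

(** * The incidence structure after a cut *)

Section Split.
Variables (V F : finType) (inc : V -> F -> bool).
Variables (F0 x y : F) (v0 c1 cy vy : V) (C : pred V).

(** [None] is the facet cut off, and [inr true] and [inr false] are the ends of the chord on [x] and
    [y]. The vertices in [C] pass from [F0] to [None], while [Some F0] remains the outer facet. *)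
Definition split_inc (v : V + bool) (f : option F) : bool :=
  match v, f with
  | inl v, Some f => inc v f && ~~ (C v && (f == F0))
  | inl v, None => C v
  | inr b, Some f => (f == F0) || (f == if b then x else y)
  | inr _, None => true
  end.

(** The chord crosses the edges [v0 c1] and [cy vy] of [F0]; by [cut_cross] only [x] and [y] meet
    both arcs. *)
Record cut : Prop := Cut {
  cut_sub : forall v, C v -> inc v F0;
  cut_v0 : ~~ C v0;
  cut_c1 : C c1;
  cut_cy : C cy;
  cut_vy : ~~ C vy;
  cut_x : forall f, inc v0 f && inc c1 f = (f == F0) || (f == x);
  cut_y : forall f, inc cy f && inc vy f = (f == F0) || (f == y);
  cut_x0 : x != F0;
  cut_y0 : y != F0;
  cut_xy : x != y;
  cut_cross : forall g v w, g != F0 -> ~~ C v -> C w -> inc v F0 -> inc v g -> inc w g ->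
    g = x \/ g = y }.

Hypothesis (simp : simple_inc inc) (ct : cut).

Let v0F0 : inc v0 F0.
Proof. by have := cut_x ct F0; rewrite eqxx => /andP[]. Qed.
Let v0x : inc v0 x.
Proof. by have := cut_x ct x; rewrite eqxx orbT => /andP[]. Qed.
Let c1x : inc c1 x.
Proof. by have := cut_x ct x; rewrite eqxx orbT => /andP[]. Qed.
Let vyF0 : inc vy F0.
Proof. by have := cut_y ct F0; rewrite eqxx => /andP[]. Qed.
Let vyy : inc vy y.
Proof. by have := cut_y ct y; rewrite eqxx orbT => /andP[]. Qed.
Let cyy : inc cy y.
Proof. by have := cut_y ct y; rewrite eqxx orbT => /andP[]. Qed.

Lemma split_three v : exists p q r, uniq [:: p; q; r] /\
  forall f, split_inc v f = (f \in [:: p; q; r]).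
Proof.
case: v => [v|b].
  have [Cv|nCv] := boolP (C v).
    have [p [q [u h]]] := three_other simp (cut_sub ct Cv).
    exists None, (Some p), (Some q); split.
      by move: u; rewrite /= !inE => /andP[_].
    move=> [f|] /=; last by rewrite Cv.
    rewrite Cv h !inE /=; move: u; rewrite /= !inE negb_or => /andP[/andP[n1 n2] _].
    by rewrite !some_eq; have [->|] := eqVneq f F0;
      rewrite ?andbT ?andbF //= (negbTE n1) (negbTE n2).
  have [p [q [r [u h]]]] := simple_three simp v.
  exists (Some p), (Some q), (Some r); split; first by [].
  by move=> [f|] /=; [rewrite (negbTE nCv) andbT h | rewrite (negbTE nCv)].
exists None, (Some F0), (Some (if b then x else y)); split.
  rewrite /= !inE /= andbT some_eq eq_sym.
  by case: b; rewrite ?(cut_x0 ct) ?(cut_y0 ct).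
by move=> [f|] //=; rewrite !inE /=.
Qed.

Definition edge_at (v : V + bool) f g := exists w h,
  [/\ split_inc w f, split_inc w g, split_inc v h & ~~ split_inc w h].

Lemma edge_atC v f g : edge_at v f g -> edge_at v g f.
Proof. by case=> w [h [? ? ? ?]]; exists w, h. Qed.

(** If the neighbour along the edge of [F0] and [g] lies on the other arc, then [g] is [x] or [y],
    and the end of the chord on [g] takes its place. The same argument serves [edge_old]. *)
Lemma edge_new v g : C v -> g != F0 -> inc v g -> edge_at (inl v) None (Some g).
Proof.
move=> Cv gF vg.
have [w [h [wF wg vh nwh]]] := simple_edge simp (introN eqP (nesym (elimN eqP gF))) (cut_sub ct Cv) vg.
have hF : h != F0 by apply: contraNneq nwh => ->.
have hg : h != g by apply: contraNneq nwh => ->.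
have [Cw|nCw] := boolP (C w).
  exists (inl w), (Some h); split => //=.
  - by rewrite wg (negbTE gF) andbF.
  - by rewrite vh (negbTE hF) andbF.
  - by rewrite (negbTE nwh).
have e := cut_cross ct gF nCw Cv wF wg vg.
exists (inr (g == x)), (Some h); split => //=.
- by case: e => ->; rewrite ?(eq_sym y x) ?(negbTE (cut_xy ct)) !eqxx orbT.
- by rewrite vh (negbTE hF) andbF.
- rewrite (negbTE hF) /=; case: e hg => ->; first by rewrite eqxx.
  by rewrite (eq_sym y x) (negbTE (cut_xy ct)).
Qed.

Lemma edge_old v g : ~~ C v -> inc v F0 -> g != F0 -> inc v g ->
  edge_at (inl v) (Some F0) (Some g).
Proof.
move=> nCv vF gF vg.
have [w [h [wF wg vh nwh]]] := simple_edge simp (introN eqP (nesym (elimN eqP gF))) vF vg.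
have hF : h != F0 by apply: contraNneq nwh => ->.
have hg : h != g by apply: contraNneq nwh => ->.
have [Cw|nCw] := boolP (C w); last first.
  exists (inl w), (Some h); split => //=.
  - by rewrite wF (negbTE nCw).
  - by rewrite wg (negbTE nCw).
  - by rewrite vh (negbTE hF) andbF.
  - by rewrite (negbTE nwh).
have e := cut_cross ct gF nCv Cw vF vg wg.
exists (inr (g == x)), (Some h); split => //=.
- by rewrite eqxx.
- by case: e => ->; rewrite ?(eq_sym y x) ?(negbTE (cut_xy ct)) !eqxx orbT.
- by rewrite vh (negbTE hF) andbF.
- rewrite (negbTE hF) /=; case: e hg => ->; first by rewrite eqxx.
  by rewrite (eq_sym y x) (negbTE (cut_xy ct)).
Qed.

Lemma edge_away v f g : f != g -> f != F0 -> g != F0 -> inc v f -> inc v g ->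
  edge_at (inl v) (Some f) (Some g).
Proof.
move=> fg fF gF vf vg.
have [w [h [wf wg vh nwh]]] := simple_edge simp fg vf vg.
exists (inl w), (if C v && (h == F0) then None else Some h); split => /=.
- by rewrite wf (negbTE fF) andbF.
- by rewrite wg (negbTE gF) andbF.
- by case: ifP => /= [/andP[]//|->]; rewrite vh.
- case: ifP => /= [/andP[_ /eqP hF]|_]; last by rewrite (negbTE nwh).
  by apply: contra nwh => /(cut_sub ct); rewrite hF.
Qed.

Lemma edge_X b : let xb := if b then x else y in
  [/\ edge_at (inr b) None (Some F0), edge_at (inr b) None (Some xb) &
      edge_at (inr b) (Some F0) (Some xb)].
Proof.
have xF := cut_x0 ct; have yF := cut_y0 ct; have xy := cut_xy ct.
split.
- exists (inr (~~ b)), (Some (if b then x else y)); split => //=; rewrite ?eqxx ?orbT //.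
  by case: b; rewrite /= ?(negbTE xF) ?(negbTE yF) ?(negbTE xy) // eq_sym (negbTE xy).
- exists (inl (if b then c1 else cy)), (Some F0); split => //=; rewrite ?eqxx //.
  + by case: b; rewrite ?(cut_c1 ct) ?(cut_cy ct).
  + by case: b; rewrite ?c1x ?cyy ?(negbTE xF) ?(negbTE yF) andbF.
  + by case: b; rewrite ?(cut_c1 ct) ?(cut_cy ct) andbF.
- exists (inl (if b then v0 else vy)), None; split => //=.
  + by case: b; rewrite ?v0F0 ?vyF0 ?(negbTE (cut_v0 ct)) ?(negbTE (cut_vy ct)).
  + by case: b; rewrite ?v0x ?vyy ?(negbTE (cut_v0 ct)) ?(negbTE (cut_vy ct)).
  + by case: b; rewrite ?(cut_v0 ct) ?(cut_vy ct).
Qed.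

Lemma split_edge v f g : f != g -> split_inc v f -> split_inc v g -> edge_at v f g.
Proof.
case: v => [v|b] fg.
  wlog : f g fg / f = None \/ f = Some F0 \/ (g != None /\ g != Some F0 /\ f != None /\ f != Some F0).
    move=> hw vf vg.
    have [fN|fN] := eqVneq f None; first by apply: hw => //; left.
    have [gN|gN] := eqVneq g None.
      by apply/edge_atC/hw => //; [rewrite eq_sym | left].
    have [fF|fF] := eqVneq f (Some F0); first by apply: hw => //; right; left.
    have [gF|gF] := eqVneq g (Some F0).
      by apply/edge_atC/hw => //; [rewrite eq_sym | right; left].
    by apply: hw => //; right; right.
  case=> [f0|[f0|[gN [gF [fN fF]]]]] vf vg.
  - subst f; case: g fg vg => //= g _ /andP[vg]; move: vf => /= Cv; rewrite Cv /= => gF.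
    exact: edge_new.
  - subst f; move: vf => /= /andP[vF]; rewrite eqxx andbT => nCv.
    case: g fg vg => /= [g fg /andP[vg _]|_ Cv]; last by rewrite Cv in nCv.
    by apply: edge_old => //; rewrite eq_sym.
  - case: f g fg gN gF fN fF vf vg => //= f [] // g fg _ gF _ fF /andP[vf _] /andP[vg _].
    exact: edge_away.
have [e1 e2 e3] := edge_X b.
case: f g fg => [f|] [g|] // fg /=; rewrite ?some_eq in fg *.
- case/orP=> /eqP e /orP[]/eqP e'; subst; rewrite ?eqxx // in fg *.
  exact: edge_atC.
- by move=> /orP[]/eqP-> _; apply: edge_atC.
- by move=> _ /orP[]/eqP->.
Qed.

Lemma split_facet f : exists v, split_inc v f.
Proof.
case: f => [f|]; last by exists (inr true).
have [->|fF] := eqVneq f F0; first by exists (inr true); rewrite /= eqxx.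
by have [v vf] := simple_facet simp f; exists (inl v); rewrite /= vf (negbTE fF) andbF.
Qed.

Lemma split_inj u v : (forall f, split_inc u f -> split_inc v f) -> u = v.
Proof.
have xF := cut_x0 ct; have yF := cut_y0 ct; have xy := cut_xy ct.
case: u v => [u|b] [v|b'] h.
- congr inl; apply: (simple_inj simp) => f uf.
  have [Cu|nCu] := boolP (C u).
    have [->|fF] := eqVneq f F0; first exact: (cut_sub ct) (h None Cu).
    by have := h (Some f); rewrite /= uf (negbTE fF) andbF => /(_ isT) /andP[].
  by have := h (Some f); rewrite /= uf (negbTE nCu) => /(_ isT) /andP[].
(* A new vertex lies on only one old facet besides [F0], an old vertex on at least two. *)
- exfalso; set xb := if b' then x else y.
  have xbF : xb != F0 by rewrite /xb; case: (b').
  have old f : f != F0 -> inc u f -> f = xb.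
    move=> fF uf; have := h (Some f); rewrite /= uf (negbTE fF) andbF /=.
    by move=> /(_ isT) /eqP.
  have [uF|nuF] := boolP (inc u F0).
    have [p [q [uq hu]]] := three_other simp uF.
    move: uq; rewrite /= !inE negb_or andbT => /andP[/andP[Fp Fq]].
    have -> : p = xb by apply: old; rewrite ?hu ?inE ?eqxx ?orbT // eq_sym.
    have -> : q = xb by apply: old; rewrite ?hu ?inE ?eqxx ?orbT // eq_sym.
    by rewrite eqxx.
  have [p [q [r [uq hu]]]] := simple_three simp u.
  have nF f : inc u f -> f != F0 by apply: contraTneq => ->.
  have up : inc u p by rewrite hu inE eqxx.
  have uq' : inc u q by rewrite hu !inE eqxx orbT.
  by move: uq; rewrite (old p (nF p up) up) (old q (nF q uq') uq') /= !inE eqxx.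
- have Cv := h None isT; have := h (Some F0); rewrite /= eqxx /= => /(_ isT) /andP[_].
  by rewrite (Cv : C v).
- case: b b' h => [] [] h //; exfalso.
    have := h (Some x); rewrite /= eqxx orbT (negbTE xF) (negbTE xy) => /(_ isT); by [].
  have := h (Some y); rewrite /= eqxx orbT (negbTE yF) eq_sym (negbTE xy) => /(_ isT); by [].
Qed.

Lemma split_simple : simple_inc split_inc.
Proof. by split; [apply: split_three | apply: split_edge | apply: split_facet | apply: split_inj]. Qed.

Lemma split_fsize_old f : f != F0 -> fsize split_inc (Some f) = fsize inc f + (f == x) + (f == y).
Proof.
move=> fF; rewrite /fsize big_sumType big_bool /= (negbTE fF) /= addnA.
by congr (_ + _ + _); apply: eq_bigr => v _; rewrite andbF andbT.
Qed.

Lemma split_fsize_new : fsize split_inc None = #|C| + 2.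
Proof.
rewrite /fsize big_sumType big_bool /=; congr (_ + _).
by rewrite -sum1_card [RHS]big_mkcond; apply: eq_bigr => v _; rewrite unfold_in; case: (C v).
Qed.

End Split.

(** * Chords in terms of the ring, and their effect on flagness *)

Record ringed (V F : finType) (inc : V -> F -> bool) (F0 : F) (rg : seq (V * F)) (ds : seq F) :
    Prop := Ringed {
  ringed_ring : ring inc F0 (last F0 (map snd rg)) rg;
  ringed_uniqv : uniq (map fst rg);
  ringed_memv : forall v, inc v F0 = (v \in map fst rg);
  ringed_uniqf : uniq (F0 :: map snd rg ++ ds);
  ringed_memf : forall f, f \in F0 :: map snd rg ++ ds }.

Section RingSplit.
Variables (V F : finType) (inc : V -> F -> bool) (F0 x y : F) (v0 cy : V).
Variables (lM lr : seq (V * F)) (ds : seq F).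
Let rg := (v0, x) :: lM ++ (cy, y) :: lr.
Hypotheses (simp : simple_inc inc) (lr0 : lr != [::]) (rd : ringed inc F0 rg ds).

Definition cut_set : pred V := fun v => v \in rcons (map fst lM) cy.

Definition cut_first : V := head cy (map fst lM).
Definition cut_next : V := head v0 (map fst lr).

Let lF := last F0 (map snd lr).

Let ring_parts : [/\ forall f, inc v0 f = (f \in [:: F0; lF; x]), ring inc F0 x (rcons lM (cy, y)),
  ring inc F0 y lr, forall f, inc cy f = (f \in [:: F0; last x (map snd lM); y]) &
  ring inc F0 x lM].
Proof.
case: (rd) => [+ _ _ _ _]; rewrite /rg /= map_cat last_cat /= => -[h0 /ring_cat[hM [hy hr]]].
split => //.
- have -> : lF = last y (map snd lr) by rewrite /lF; case: (lr) lr0.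
  exact: h0.
- by rewrite -cats1; apply/ring_cat; split.
Qed.

Let perm_parts : perm_eq (F0 :: map snd rg ++ ds) (F0 :: x :: y :: map snd lM ++ map snd lr ++ ds).
Proof.
rewrite /rg /= map_cat -catA /= !perm_cons.
exact: (permEl (perm_catCA (map snd lM) [:: y] _)).
Qed.

Let uniq_parts : uniq (F0 :: x :: y :: map snd lM ++ map snd lr ++ ds).
Proof. by rewrite -(perm_uniq perm_parts); apply: ringed_uniqf rd. Qed.

Let memv v : inc v F0 = [|| v == v0, cut_set v | v \in map fst lr].
Proof.
by rewrite (ringed_memv rd) /rg /= map_cat inE mem_cat /= inE /cut_set mem_rcons inE; do !bool_congr.
Qed.

Let uniqv : [/\ ~~ cut_set v0, {in map fst lr, forall v, ~~ cut_set v} & uniq (rcons (map fst lM) cy)].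
Proof.
have := ringed_uniqv rd; rewrite /rg /= map_cat /= -cat_rcons cat_uniq mem_cat negb_or.
move=> /andP[/andP[n0 _] /and3P[u /hasPn h _]]; split=> //.
Qed.

Let xF : x != F0. Proof. by have := uniq_parts; rewrite /= !inE !negb_or eq_sym => /andP[/andP[]]. Qed.
Let yF : y != F0.
Proof. by have := uniq_parts; rewrite /= !inE !negb_or (eq_sym _ y) => /andP[/and3P[]]. Qed.
Let xy : x != y.
Proof. by have := uniq_parts; rewrite /= !inE !negb_or => /and3P[_ /andP[]]. Qed.

Let cut_facets v f : cut_set v -> inc v f -> f \in [:: F0, x, y & map snd lM].
Proof.
case: ring_parts => _ hM _ _ _ Cv vf.
have := @ring_mem _ _ inc F0 x _ v f hM; rewrite !map_rcons => /(_ Cv vf).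
by rewrite !inE mem_rcons inE.
Qed.

Let uncut_facets v f : ~~ cut_set v -> inc v F0 -> inc v f -> f \in [:: F0, x, y & map snd lr].
Proof.
case: ring_parts => h0 _ hr _ _ nCv; rewrite memv (negbTE nCv) /= => /orP[/eqP->|vr].
  rewrite h0 !inE => /or3P[->|/eqP->|->]; rewrite ?orbT //.
  by rewrite /lF; case: (lr) lr0 => //= a l _; rewrite mem_last !orbT.
move=> vf; have := ring_mem hr vr vf.
by rewrite !inE => /or3P[]->; rewrite ?orbT.
Qed.

Lemma cross g v w : g != F0 -> ~~ cut_set v -> cut_set w -> inc v F0 -> inc v g -> inc w g ->
  g = x \/ g = y.
Proof.
move=> gF nCv Cw vF vg wg.
have := cut_facets Cw wg; have := uncut_facets nCv vF vg.
rewrite !inE (negbTE gF) /= => /or3P[/eqP->|/eqP->|gr]; [by left | by right |].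
case/or3P=> [/eqP->|/eqP->|gM]; [by left | by right |].
have := uniq_parts; rewrite /= !cat_uniq => /and4P[_ _ _ /and3P[_ /hasPn h _]].
by have := h g; rewrite mem_cat gr => /(_ isT); rewrite /= gM.
Qed.

(** Together with [uncut_both], this is how nonempty sides of a chord protect flagness: [x] and [y]
    then share no vertex of [F0]. *)
Lemma cut_both v : lM != [::] -> cut_set v -> inc v x -> inc v y -> False.
Proof.
case: ring_parts => _ + _ _ _; have := uniq_parts; rewrite /cut_set.
case: (lM) => // -[c m] l /= u [hc hl] _; rewrite inE => /orP[/eqP->|vl] vx.
  rewrite hc !inE (negbTE yF) (eq_sym y) (negbTE xy) /= => /eqP ym.
  by move: u; rewrite ym !inE /= eqxx => /and3P[_ _ /andP[]].
have := @ring_mem _ _ inc F0 m _ v x hl; rewrite !map_rcons => /(_ vl vx).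
rewrite !inE (negbTE xF) mem_rcons inE (negbTE xy) /=.
by move: u => /and3P[_ + _]; rewrite !inE mem_cat !negb_or => /and3P[_ /negbTE-> /andP[/negbTE->]].
Qed.

Lemma uncut_both v : ~~ cut_set v -> inc v F0 -> inc v x -> inc v y -> False.
Proof.
case: ring_parts => h0 _ hr _ _ nCv; rewrite memv (negbTE nCv) /= => /orP[/eqP->|vr].
  rewrite !h0 !inE (negbTE yF) (eq_sym y x) (negbTE xy) orbF /= => _ /eqP ylF.
  have := uniq_parts; rewrite ylF /lF; case: (lr) lr0 => //= a l _ /and3P[_ _ /andP[+ _]].
  by rewrite mem_cat -cat_cons mem_cat mem_last orbT.
move=> /(ring_mem hr vr); rewrite !inE (negbTE xF) (negbTE xy) /= => xr.
by have := uniq_parts => /and3P[_ + _]; rewrite !inE !mem_cat xr !orbT.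
Qed.

Lemma ring_cut : cut inc F0 x y v0 cut_first cy cut_next cut_set.
Proof.
have [h0 hM hr hy hM'] := ring_parts; have [n0 nr uM] := uniqv.
split => //.
- by move=> v Cv; rewrite memv Cv orbT.
- by rewrite /cut_set /cut_first; case: (lM) => [|[c m] l] /=; rewrite !inE eqxx.
- by rewrite /cut_set mem_rcons inE eqxx.
- by rewrite /cut_next; case: (lr) lr0 nr => //= -[v r] l _ nr; apply: nr; rewrite inE eqxx.
- move=> f; rewrite h0.
  have [m [mx mE]] : exists m, m != lF /\ forall f, inc cut_first f = (f \in [:: F0; x; m]).
    have := uniq_parts; move: hM; rewrite /lF /cut_first.
    case: (lM) => [|[c m] l] /= [hc _].
      move=> /and4P[_ _ + _]; case: (lr) lr0 => //= a l _ yl.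
      exists y; split => //; apply: contraNneq yl => ->.
      by rewrite -cat_cons mem_cat mem_last.
    case: (lr) lr0 => //= a l' _ /and3P[_ _ /and3P[_ ml _]]; exists m; split => //.
    by apply: contraNneq ml => ->; rewrite mem_cat -cat_cons mem_cat mem_last orbT.
  rewrite mE !inE; have [->|fF] := eqVneq f F0; first by [].
  have [->|fx] /= := eqVneq f x; first by rewrite orbT.
  by rewrite !orbF; apply: contraNF mx => /andP[/eqP-> /eqP->].
- move=> f; rewrite hy.
  have [m [mx mE]] : exists m, m != last x (map snd lM) /\
      forall f, inc cut_next f = (f \in [:: F0; y; m]).
    have := uniq_parts; move: hr; rewrite /cut_next.
    case: (lr) lr0 => // -[v m] l _ /= [hv _] u; exists m; split => //.
    apply/negP => /eqP e.
    have : m \in x :: map snd lM by rewrite e mem_last.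
    move: u => /= /and4P[_ + _]; rewrite !inE !mem_cat !inE !negb_or cat_uniq.
    move=> /and3P[_ xm /andP[/negbTE xr _]] /and3P[_ /hasPn h _].
    have := h m; rewrite !inE eqxx => /(_ isT) /= /negbTE ->; rewrite orbF => /eqP mx.
    by move: xr; rewrite mx eqxx.
  rewrite mE !inE; have [->|fF] := eqVneq f F0; first by [].
  have [->|fy] /= := eqVneq f y; first by rewrite orbT.
  by rewrite !orbF; apply: contraNF mx => /andP[/eqP<- /eqP->].
- exact: cross.
Qed.

Let inc' := split_inc inc F0 x y cut_set.

Definition lift_corner (c : V * F) : (V + bool) * option F := (inl c.1, Some c.2).

Definition new_ring : seq ((V + bool) * option F) :=
  [:: (inl v0, Some x), (inr true, None), (inr false, Some y) & map lift_corner lr].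

Definition new_done : seq (option F) := map Some (map snd lM ++ ds).

Lemma lift_snd l : map snd (map lift_corner l) = map Some (map snd l).
Proof. by rewrite -!map_comp. Qed.

Lemma lift_fst l : map fst (map lift_corner l) = map inl (map fst l).
Proof. by rewrite -!map_comp. Qed.

Lemma lift_ring p l : (forall v, v \in map fst l -> ~~ cut_set v) -> ring inc F0 p l ->
  ring inc' (Some F0) (Some p) (map lift_corner l).
Proof.
elim: l p => //= -[v g] l IH p h [hv hl]; split; last first.
  by apply: IH => // w wl; apply: h; rewrite inE wl orbT.
have nv : ~~ cut_set v by apply: h; rewrite inE eqxx.
move=> [f|] /=; last by rewrite (negbTE nv).
by rewrite (negbTE nv) andbT hv !inE !some_eq.
Qed.

Let perm_new : perm_eq (Some F0 :: map snd new_ring ++ new_done)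
  (None :: map Some [:: F0, x, y & map snd lM ++ map snd lr ++ ds]).
Proof. by rewrite /new_ring /new_done /= lift_snd; apply/permP => P; rewrite /= !map_cat !count_cat; lia. Qed.

Lemma new_ringed : ringed inc' (Some F0) new_ring new_done.
Proof.
have [h0 hM hr hy hM'] := ring_parts; have [n0 nr uM] := uniqv.
have lastE a : last a (map snd (map lift_corner lr)) = Some lF.
  rewrite lift_snd /lF.
  by case: (lr) lr0 => //= c l _; rewrite last_map.
split.
- split; last split; last split; last exact: lift_ring.
  + move=> [f|] /=; last by rewrite (negbTE n0) !inE lastE.
    by rewrite lastE (negbTE n0) andbT h0 !inE !some_eq.
  + by move=> [f|] //=; rewrite !inE !some_eq orbF.
  + by move=> [f|] //=; rewrite !inE !some_eq.
- rewrite /= lift_fst !inE /= map_inj_uniq; last by move=> ? ? [].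
  have inl_in b : inr b \in [seq inl i | i <- [seq i.1 | i <- lr]] = false :> bool.
    by apply/negP => /mapP[].
  rewrite !inl_in /= mem_map; last by move=> ? ? [].
  have := ringed_uniqv rd; rewrite /rg /= map_cat /= mem_cat inE !negb_or cat_uniq /=.
  by move=> /andP[/and3P[_ _ ->] /and4P[_ _ _ ->]].
- move=> [v|b] /=; rewrite !inE lift_fst /= ?eqxx ?orbT; last by case: b.
  rewrite mem_map; last by move=> ? ? [].
  rewrite andbT memv -[inl v == inl v0]/(v == v0).
  have [->|_] /= := eqVneq v v0; first by rewrite n0.
  have [/nr/negbTE->|nvr] := boolP (v \in map fst lr); first by rewrite orbT.
  by rewrite orbF andbN.
- rewrite (perm_uniq perm_new) cons_uniq map_inj_uniq; last by move=> ? ? [].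
  by rewrite uniq_parts andbT; apply/negP => /mapP[].
- move=> f; rewrite (perm_mem perm_new); case: f => [f|]; last exact: mem_head.
  by rewrite in_cons map_f ?orbT // -(perm_mem perm_parts) (ringed_memf rd).
Qed.

(** The cut can be undone: sending [None] to [F0] and the two new vertices to [v0] and [cy]
    preserves incidences. *)
Lemma meet_old f g : (exists v, inc' v f && inc' v g) ->
  exists v, inc v (odflt F0 f) && inc v (odflt F0 g).
Proof.
have ct := ring_cut; case=> v /andP[vf vg].
suff [w h] : exists w, forall f, inc' v f -> inc w (odflt F0 f) by exists w; rewrite !h.
case: v {vf vg} => [v|b].
  by exists v => -[h|] /=; [case/andP | apply: (cut_sub ct)].
exists (if b then v0 else cy) => -[h|_] /=.
  case: b; first by rewrite -(cut_x ct) => /andP[].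
  by rewrite -(cut_y ct) => /andP[].
by case: b; rewrite memv /cut_set ?mem_rcons ?inE ?eqxx ?orbT.
Qed.

Lemma meet_uncut g : g != F0 -> (exists v, inc' v (Some g) && inc' v (Some F0)) ->
  exists v, [/\ ~~ cut_set v, inc v F0 & inc v g].
Proof.
have ct := ring_cut; move=> gF [[v|b]] /= /andP[].
  by move=> /andP[vg _]; rewrite eqxx andbT => /andP[vF nv]; exists v.
rewrite (negbTE gF) /= => /eqP-> _; case: b.
  by exists v0; rewrite (cut_v0 ct); have := cut_x ct F0; have := cut_x ct x;
    rewrite !eqxx orbT => /andP[-> _] /andP[-> _].
by exists cut_next; rewrite (cut_vy ct); have := cut_y ct F0; have := cut_y ct y;
  rewrite !eqxx orbT => /andP[_ ->] /andP[_ ->].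
Qed.

Lemma meet_cut g : g != F0 -> (exists v, inc' v (Some g) && inc' v None) ->
  exists v, cut_set v /\ inc v g.
Proof.
have ct := ring_cut; move=> gF [[v|b]] /= /andP[]; first by move=> /andP[vg _] Cv; exists v.
rewrite (negbTE gF) /= => /eqP-> _; case: b.
  by exists cut_first; rewrite (cut_c1 ct); have := cut_x ct x;
    rewrite !eqxx orbT => /andP[_ ->].
by exists cy; rewrite (cut_cy ct); have := cut_y ct y; rewrite !eqxx orbT => /andP[-> _].
Qed.

Lemma common_chord (S : {set option F}) :
  (forall g, Some g \in S -> g != F0 -> g = x \/ g = y) ->
  ~ (Some x \in S /\ Some y \in S) -> common inc' S.
Proof.
move=> h nxy; exists (inr (Some x \in S)) => -[f|//] fS /=.
have [//|fF] := eqVneq f F0; case: (h f fS fF) => e; subst f; first by rewrite fS eqxx.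
by case: ifP => [xS|_]; [case: nxy | rewrite eqxx].
Qed.

(* The three situations in which chords are drawn: flagness is preserved when the chord cuts off
   a whole side, weakened when it cuts off a single vertex, and restored when the side [z] along
   which the weakening took place is cut off. *)
Definition chord_mode (Z : option F) (Z' : option (option F)) : Prop :=
  [\/ [/\ lM != [::], Z = None & Z' = None],
      [/\ lM = [::], Z = None \/ Z = Some x & Z' = Some (Some x)] |
      exists c z, [/\ lM = [:: (c, z)], Z = Some z & Z' = None]].

(** The cut is undone on [S], giving [S0]. If a common vertex of [S0] lies on the wrong arc for [S],
    all facets of [S] other than [F0] and [None] meet both arcs, so they are [x] or [y], and an end
    of the chord is common unless both occur. *)
Lemma new_flag Z Z' : chord_mode Z Z' -> flag_but inc F0 Z -> flag_but inc' (Some F0) Z'.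
Proof.
have ct := ring_cut; move=> mode fl S meetS.
pose S0 := [set f | (Some f \in S) || (f == F0) && (None \in S)].
have S0E f : f \in S0 = (Some f \in S) || (f == F0) && (None \in S) by rewrite inE.
have inS0 f : Some f \in S -> f \in S0 by rewrite S0E => ->.
have meet0 : pairwise_meet inc S0.
  have lft f : f \in S0 -> exists2 f', f' \in S & odflt F0 f' = f.
    by rewrite S0E => /orP[fS|/andP[/eqP-> NS]]; [exists (Some f) | exists None].
  move=> f g /lft[f' fS <-] /lft[g' gS <-].
  exact/meet_old/meetS.
have both v : cut_set v -> inc v x -> inc v y -> Z' = Some (Some x).
  move=> Cv vx vy; case: mode => [[lM1 _ _]|[_ _ ->//]|[c [z [lMe _ _]]]].
    by case: (cut_both lM1 Cv vx vy).
  by case: (@cut_both v); rewrite ?lMe.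
have [[v vS]|bad] := fl _ meet0.
  have inl_good : ~~ (cut_set v && (Some F0 \in S)) -> (None \in S -> cut_set v) -> common inc' S.
    move=> nC NC; exists (inl v) => -[f|] fS /=; last exact: NC.
    rewrite vS ?inS0 //=; apply: contra nC => /andP[-> /eqP <-].
    by rewrite fS.
  have near g : Some g \in S -> g != F0 ->
      (cut_set v && (Some F0 \in S)) || (~~ cut_set v && (None \in S)) -> g = x \/ g = y.
    move=> gS gF /orP[/andP[Cv FS]|/andP[nCv NS]].
      have [w [nCw wF wg]] := meet_uncut gF (meetS _ _ gS FS).
      exact: (cut_cross ct gF nCw Cv wF wg (vS _ (inS0 _ gS))).
    have [w [Cw wg]] := meet_cut gF (meetS _ _ gS NS).
    have vF : inc v F0 by apply: vS; rewrite S0E eqxx NS orbT.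
    exact: (cut_cross ct gF nCv Cw vF (vS _ (inS0 _ gS)) wg).
  have [Cv|nCv] := boolP (cut_set v).
    have [FS|FS] := boolP (Some F0 \in S); last first.
      by left; apply: inl_good; rewrite ?(negbTE FS) ?andbF.
    have h g : Some g \in S -> g != F0 -> g = x \/ g = y.
      by move=> gS gF; apply: near; rewrite ?Cv ?FS.
    have [/andP[xS yS]|nxy] := boolP ((Some x \in S) && (Some y \in S)).
      by right; rewrite (both v Cv (vS _ (inS0 _ xS)) (vS _ (inS0 _ yS))).
    by left; apply: common_chord => //; apply/andP.
  have [NS|NS] := boolP (None \in S); last first.
    by left; apply: inl_good; rewrite ?(negbTE nCv) // (negbTE NS).
  left; apply: common_chord => [g gS gF|[xS yS]].
    by apply: near; rewrite ?NS ?nCv ?orbT.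
  have vF : inc v F0 by apply: vS; rewrite S0E eqxx NS orbT.
  exact: (uncut_both nCv vF (vS _ (inS0 _ xS)) (vS _ (inS0 _ yS))).
move: bad mode; case: Z fl => // z fl [FS0 zS0] [[_ //]|[lMe [//|[zx]] Z'E]|[c [z' [lMe [zz] Z'E]]]].
  (* Another vertex cut along the same side: unless [F0] is in [S], all facets of [S] meet the new
     triangle, and its remaining old vertex [cy] is common. *)
  subst z; rewrite Z'E; move: zS0; rewrite S0E (negbTE xF) orbF => xS.
  have [FS|FS] := boolP (Some F0 \in S); first by right.
  have NS : None \in S by move: FS0; rewrite S0E (negbTE FS) eqxx.
  left; exists (inl cy) => -[g|_] /=; last exact: (cut_cy ct).
  move=> gS; have gF : g != F0 by apply: contraNneq FS => <-.
  rewrite (negbTE gF) !andbF andbT.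
  have [w [+ wg]] := meet_cut gF (meetS _ _ gS NS).
  by rewrite /cut_set lMe /= inE => /eqP <-.
(* Covering [z] separates it from [F0], so an exempted set now consists of [None] and facets at [c]
   or [cy]. It could fail only by containing both [x] and [y]; but then [F0], [x], [y] already
   violated the old hypothesis without involving [z]. *)
subst z'; rewrite Z'E; left.
have [h0 hM hr hy hM'] := ring_parts.
have cE f : inc c f = (f \in [:: F0; x; z]) by move: hM; rewrite lMe => -[+ _]; apply.
have yE f : inc cy f = (f \in [:: F0; z; y]) by rewrite hy lMe.
have zu : [/\ z != F0, z != x & z != y].
  have := uniq_parts; rewrite lMe /= !inE !negb_or -!andbA (eq_sym z) (eq_sym z) (eq_sym z).
  by move=> /and5P[_ _ -> _ /and4P[_ -> _ /andP[-> _]]].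
have [zF zx zy] := zu.
have Cc : cut_set c by rewrite /cut_set lMe !inE eqxx.
have Ccy := cut_cy ct.
have zS : Some z \in S by move: zS0; rewrite S0E (negbTE zF) orbF.
have NS : None \in S.
  move: FS0; rewrite S0E eqxx /= => /orP[FS|//].
  have [w [nw wF wz]] := meet_uncut zF (meetS _ _ zS FS).
  have [|e|e] := cut_cross ct zF nw Cc wF wz; first by rewrite cE !inE eqxx !orbT.
    by rewrite e eqxx in zx.
  by rewrite e eqxx in zy.
have FS : Some F0 \notin S.
  apply/negP => FS; have [w [nw wF wz]] := meet_uncut zF (meetS _ _ zS FS).
  have [|e|e] := cut_cross ct zF nw Cc wF wz; first by rewrite cE !inE eqxx !orbT.
    by rewrite e eqxx in zx.
  by rewrite e eqxx in zy.
have near g : Some g \in S -> [\/ g = x, g = z | g = y].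
  move=> gS; have gF : g != F0 by apply: contraNneq FS => <-.
  have [w [+ wg]] := meet_cut gF (meetS _ _ gS NS).
  rewrite /cut_set lMe !inE => /orP[] /eqP e; move: wg; rewrite e ?cE ?yE !inE (negbTE gF) /=.
    by case/orP => /eqP ->; [constructor 1 | constructor 2].
  by case/orP => /eqP ->; [constructor 2 | constructor 3].
have nF g : Some g \in S -> (g == F0) = false by move=> gS; apply: contraNF FS => /eqP <-.
have [/andP[xS yS]|] := boolP ((Some x \in S) && (Some y \in S)); last first.
  rewrite negb_and => /orP[nx|ny].
    exists (inl cy) => -[g|_] //= gS; rewrite nF // andbF andbT yE !inE.
    by case: (near g gS) => e; rewrite e ?eqxx ?orbT //; rewrite -e gS in nx.
  exists (inl c) => -[g|_] //= gS; rewrite nF // andbF andbT cE !inE.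
  by case: (near g gS) => e; rewrite e ?eqxx ?orbT //; rewrite -e gS in ny.
have meetT : pairwise_meet inc [set F0; x; y].
  have sub f : f \in [set F0; x; y] -> f \in S0.
    by rewrite !inE => /orP[/orP[]|] /eqP->; rewrite ?xS ?yS ?eqxx ?NS ?orbT.
  by move=> f g /sub fS /sub gS; apply: meet0.
have [[v vT]|[_ zT]] := fl _ meetT; last first.
  by move: zT; rewrite !inE (negbTE zF) (negbTE zx) (negbTE zy).
have vF : inc v F0 by apply: vT; rewrite !inE eqxx.
have vx : inc v x by apply: vT; rewrite !inE eqxx orbT.
have vyy : inc v y by apply: vT; rewrite !inE eqxx orbT.
have [Cv|nCv] := boolP (cut_set v); last by case: (uncut_both nCv vF vx vyy).
by case: (@cut_both v); rewrite ?lMe.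
Qed.

End RingSplit.

(** * Cutting a face by a chord: realization *)

Local Open Scope ring_scope.

Section Geometry.
Variable R : realType.
Local Notation point := 'rV[R]_3.

Lemma dotDl (p q a : point) : dot (p + q) a = dot p a + dot q a.
Proof. by rewrite /dot mulmxDl mxE. Qed.

Lemma dotZl t (p a : point) : dot (t *: p) a = t * dot p a.
Proof. by rewrite /dot -scalemxAl mxE. Qed.

Lemma dotDr (p a b : point) : dot p (a + b) = dot p a + dot p b.
Proof. by rewrite /dot linearD /= mulmxDr mxE. Qed.

Lemma dotZr t (p a : point) : dot p (t *: a) = t * dot p a.
Proof. by rewrite /dot linearZ /= -scalemxAr mxE. Qed.

Lemma dotNl (p a : point) : dot (- p) a = - dot p a.
Proof. by rewrite -scaleN1r dotZl mulN1r. Qed.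

Lemma dotBl (p q a : point) : dot (p - q) a = dot p a - dot q a.
Proof. by rewrite dotDl dotNl. Qed.

(** Slack of [p] in the half-space [dot p l.1 <= l.2]. *)
Definition ev (l : point * R) (p : point) : R := l.2 - dot p l.1.

Definition mix (t : R) (p q : point) : point := (1 - t) *: p + t *: q.

Lemma dot_mix t p q a : dot (mix t p q) a = (1 - t) * dot p a + t * dot q a.
Proof. by rewrite dotDl !dotZl. Qed.

Lemma ev_mix l t p q : ev l (mix t p q) = (1 - t) * ev l p + t * ev l q.
Proof. by rewrite /ev dot_mix; ring. Qed.

Lemma ev_mix_ge0 l t p q : 0 < t < 1 -> 0 <= ev l p -> 0 <= ev l q -> 0 <= ev l (mix t p q).
Proof. by move=> /andP[t0 t1] hp hq; rewrite ev_mix addr_ge0 // mulr_ge0 //; lra. Qed.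

Lemma ev_mix_eq0 l t p q : 0 < t < 1 -> 0 <= ev l p -> 0 <= ev l q ->
  (ev l (mix t p q) == 0) = (ev l p == 0) && (ev l q == 0).
Proof.
move=> /andP[t0 t1] hp hq; rewrite ev_mix paddr_eq0 ?mulr_ge0 //; try lra.
by rewrite !mulf_eq0 (gt_eqF t0) subr_eq0 (gt_eqF t1).
Qed.

Lemma mix_zero l p q : ev l p < 0 -> 0 < ev l q -> exists2 t, 0 < t < 1 & ev l (mix t p q) = 0.
Proof.
move=> hp hq; have d0 : 0 < ev l q - ev l p by lra.
exists (- ev l p / (ev l q - ev l p)).
  by rewrite divr_gt0 ?ltr_pdivrMr ?mul1r /=; lra.
rewrite ev_mix; field; lra.
Qed.

(* tilting the plane [l] around its intersection with the plane [c] *)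
Definition tilt (e : R) (l c : point * R) : point * R := (l.1 + e *: c.1, l.2 + e * c.2).

Lemma ev_tilt e l c p : ev (tilt e l c) p = ev l p + e * ev c p.
Proof. by rewrite /ev /tilt /= dotDr dotZr; ring. Qed.

Lemma small_eps (V : finType) (P : pred V) (a b : V -> R) : (forall v, P v -> 0 < a v) ->
  exists2 e, 0 < e & forall v, P v -> 0 < a v + e * b v.
Proof.
move=> a0; pose s := \sum_(v | P v) `|b v| / a v.
have s0 : 0 <= s by apply: sumr_ge0 => v /a0 av; rewrite divr_ge0 // ltW.
have s1 : 0 < 1 + s by lra.
exists (1 + s)^-1; first by rewrite invr_gt0.
move=> v Pv; have av := a0 v Pv.
have : `|b v| / a v <= s.
  rewrite /s (bigD1 v) //= lerDl sumr_ge0 // => w /andP[/a0 aw _].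
  by rewrite divr_ge0 // ltW.
rewrite ler_pdivrMr // => le.
have : `|b v| < (1 + s) * a v by apply: le_lt_trans le _; rewrite ltr_pM2r //; lra.
rewrite -ltr_pdivrMl // => lt.
have : - ((1 + s)^-1 * `|b v|) <= (1 + s)^-1 * b v.
  by rewrite -mulrN ler_pM2l ?invr_gt0 // lerNl -normrN ler_norm.
lra.
Qed.

Definition realizes (V F : finType) (inc : V -> F -> bool) (pos : V -> point) (l : F -> point * R) :=
  forall v f, 0 <= ev (l f) (pos v) /\ (ev (l f) (pos v) == 0) = inc v f.

(** [F0] keeps its plane, and the tilt is small enough that the vertices off [F0] stay strictly
    inside. Each vertex of [C] slides along its edge leaving [F0], towards [u v], until it hits the
    tilted plane; it thus stays on its two other facets. *)
Lemma split_realizes (V F : finType) (inc : V -> F -> bool) (F0 x y : F) (v0 c1 cy vy : V)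
    (C : pred V) pos l (c : point * R) :
  simple_inc inc -> cut inc F0 x y v0 c1 cy vy C -> realizes inc pos l ->
  (forall v, C v -> ev c (pos v) < 0) ->
  (forall v, inc v F0 -> ~~ C v -> 0 < ev c (pos v)) ->
  exists pos' l' t s, [/\ realizes (split_inc inc F0 x y C) pos' l',
    forall v, ~~ C v -> pos' (inl v) = pos v,
    0 < t < 1, 0 < s < 1 &
    pos' (inr true) = mix t (pos v0) (pos c1) /\ pos' (inr false) = mix s (pos cy) (pos vy)].
Proof.
move=> simp ct rl cneg cpos.
have ge0 v f : 0 <= ev (l f) (pos v) by case: (rl v f).
have eq0 v f : (ev (l f) (pos v) == 0) = inc v f by case: (rl v f).
have [e e0 he] : exists2 e, 0 < e & forall v, ~~ inc v F0 ->
    0 < ev (l F0) (pos v) + e * ev c (pos v).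
  by apply: small_eps => v nv; rewrite lt_neqAle ge0 eq_sym eq0 nv.
pose N := tilt e (l F0) c.
have Nneg v : C v -> ev N (pos v) < 0.
  move=> Cv; have /eqP h : ev (l F0) (pos v) == 0 by rewrite eq0 (cut_sub ct).
  by rewrite ev_tilt h add0r pmulr_rlt0 // cneg.
have Npos v : ~~ C v -> 0 < ev N (pos v).
  move=> nC; rewrite ev_tilt; have [vF|/he//] := boolP (inc v F0).
  by move: (vF); rewrite -eq0 => /eqP->; rewrite add0r mulr_gt0 // cpos.
have NposF v : inc v F0 -> ev N (pos v) = e * ev c (pos v).
  by rewrite -eq0 ev_tilt => /eqP->; rewrite add0r.
have /choice[u hu] : forall v, exists u, C v -> ~~ C u /\
    forall f, inc v f && inc u f = inc v f && (f != F0).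
  move=> v.
  have [Cv|] := boolP (C v); last by exists v.
  have [p [q [u0 hv]]] := three_other simp (cut_sub ct Cv).
  have [pq Fp Fq] : [/\ p != q, F0 != p & F0 != q].
    by move: u0; rewrite /= !inE negb_or andbT => /andP[/andP[-> ->] ->].
  have [||w [g [wp wq]]] := simple_edge simp (v := v) pq.
  - by rewrite hv !inE eqxx orbT.
  - by rewrite hv !inE eqxx !orbT.
  rewrite hv !inE => /or3P[] /eqP-> nw; [|by rewrite wp in nw|by rewrite wq in nw].
  exists w => _; split; first by apply: contra nw => /(cut_sub ct).
  move=> f; rewrite hv !inE; have [->|fF] := eqVneq f F0; first by rewrite (negbTE nw).
  have [->|fp] := eqVneq f p; first by rewrite wp.
  by have [->|fq] := eqVneq f q; first by rewrite wq.
have /choice[s hs] : forall v, exists s, C v ->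
    0 < s < 1 /\ ev N (mix s (pos v) (pos (u v))) = 0.
  move=> v.
  have [Cv|] := boolP (C v); last by exists 0.
  have [nCu _] := hu v Cv.
  by have [t t01 h] := mix_zero (Nneg v Cv) (Npos _ nCu); exists t.
have [tx tx01 hx] := mix_zero (Nneg _ (cut_c1 ct)) (Npos _ (cut_v0 ct)).
have [ty ty01 hy] := mix_zero (Nneg _ (cut_cy ct)) (Npos _ (cut_vy ct)).
have mixC t p q : mix t p q = mix (1 - t) q p by rewrite /mix subKr addrC.
pose pos' (v : V + bool) := match v with
  | inl v => if C v then mix (s v) (pos v) (pos (u v)) else pos v
  | inr true => mix tx (pos c1) (pos v0)
  | inr false => mix ty (pos cy) (pos vy) end.
pose l' (f : option F) := if f is Some f then l f else N.
exists pos', l', (1 - tx), ty; split.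
- move=> [v|b] [f|] /=.
  + case: ifPn => [Cv|nCv]; last by rewrite andbT.
    have [s01 _] := hs v Cv; have [_ h] := hu v Cv.
    by split; [apply: ev_mix_ge0 | rewrite ev_mix_eq0 // !eq0 h].
  + case: ifPn => [Cv|nCv]; first by have [_ ->] := hs v Cv; rewrite eqxx.
    by have := Npos v nCv => h; rewrite ltW // gt_eqF.
  + case: b.
      by split; [apply: ev_mix_ge0 | rewrite ev_mix_eq0 // !eq0 andbC (cut_x ct)].
    by split; [apply: ev_mix_ge0 | rewrite ev_mix_eq0 // !eq0 (cut_y ct)].
  + by case: b; rewrite ?hx ?hy eqxx.
- by move=> v /negbTE /= ->.
- lra.
- by [].
- by split => //=; rewrite mixC.
Qed.

Lemma subseq_consP (T : eqType) (a d : T) u v :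
  subseq (a :: u) (d :: v) -> a = d /\ subseq u v \/ subseq (a :: u) v.
Proof. by rewrite /=; case: eqP; [left | right]. Qed.

(** * Convex cyclic order of the outer vertices *)

Section Orientation.
Variables (e1 e2 : point).

(* twice the signed area of the projection of the triangle [p q r] to the coordinates [e1], [e2] *)
Definition turn (p q r : point) : R :=
  (dot q e1 - dot p e1) * (dot r e2 - dot p e2) - (dot q e2 - dot p e2) * (dot r e1 - dot p e1).

Lemma turn_rot p q r : turn p q r = turn q r p.
Proof. by rewrite /turn; ring. Qed.

Lemma turn_swap p q r : turn p q r = - turn p r q.
Proof. by rewrite /turn; ring. Qed.

Lemma turn_mix t p p' q r : turn (mix t p p') q r = (1 - t) * turn p q r + t * turn p' q r.
Proof. by rewrite /turn !dot_mix; ring. Qed.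

Lemma turn_mix2 t p q q' r : turn p (mix t q q') r = (1 - t) * turn p q r + t * turn p q' r.
Proof. by rewrite /turn !dot_mix; ring. Qed.

Lemma turn_mix3 t p q r r' : turn p q (mix t r r') = (1 - t) * turn p q r + t * turn p q r'.
Proof. by rewrite /turn !dot_mix; ring. Qed.

Lemma turn_ppq p q : turn p p q = 0.
Proof. by rewrite /turn; ring. Qed.

Lemma turn_pqq p q : turn p q q = 0.
Proof. by rewrite /turn; ring. Qed.

Lemma turn_pqp p q : turn p q p = 0.
Proof. by rewrite /turn; ring. Qed.

(** The plane through [p] and [q] parallel to the kernel of the projection to [e1], [e2]. *)
Definition chord (p q : point) : point * R :=
  ((dot q e2 - dot p e2) *: e1 - (dot q e1 - dot p e1) *: e2,
   (dot q e2 - dot p e2) * dot p e1 - (dot q e1 - dot p e1) * dot p e2).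

Lemma ev_chord p q r : ev (chord p q) r = turn p q r.
Proof. by rewrite /ev /chord /turn /= dotDr -scaleNr !dotZr; ring. Qed.

(** The geometric counterpart of the ring: triples in list order turn left. It guarantees that a
    chord of the word is a separating line. *)
Definition convex_cycle (V : eqType) (pos : V -> point) (s : seq V) : Prop :=
  forall a b c, subseq [:: a; b; c] s -> 0 < turn (pos a) (pos b) (pos c).

Lemma convex_rot (V : eqType) (pos : V -> point) u v :
  convex_cycle pos (u ++ v) -> convex_cycle pos (v ++ u).
Proof.
elim: u v => [|d u IH] v; first by rewrite cats0.
move=> h; rewrite -cat_rcons; apply: IH => a b c.
rewrite -rcons_cat -subseq_rev rev_rcons -[rev [:: a; b; c]]/([:: c; b; a]) /=.
case: eqP => [-> ba|_ cba].
  rewrite -turn_rot; apply: h => /=; rewrite eqxx.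
  by rewrite -subseq_rev.
apply: h; rewrite cat_cons; apply: subseq_trans (subseq_cons _ _).
by rewrite -subseq_rev.
Qed.

Variables (V : eqType) (pos : V -> point) (v0 cy vy : V) (cs vr : seq V).
Hypothesis h : convex_cycle pos (v0 :: rcons cs cy ++ vy :: vr).
Let c1 := head cy cs.
Let T a b c := 0 < turn (pos a) (pos b) (pos c).
Let W a b c := 0 <= turn (pos a) (pos b) (pos c).

Let c1_cs : c1 \in rcons cs cy.
Proof. by rewrite /c1; case: cs => [|c l]; rewrite /= inE eqxx. Qed.

Let T0 u w : u \in rcons cs cy -> w \in vy :: vr -> T v0 u w.
Proof.
move=> hu hw; apply: h; rewrite /= eqxx.
by apply: (@cat_subseq _ [:: u] [:: w]); rewrite sub1seq.
Qed.

Let T0cy u : u \in cs -> T v0 u cy.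
Proof.
move=> hu; apply: h; rewrite cat_rcons /= eqxx.
by apply: (@cat_subseq _ [:: u] [:: cy]); rewrite sub1seq // inE eqxx.
Qed.

Let T1 u b c : u \in v0 :: rcons cs cy -> subseq [:: b; c] (vy :: vr) -> T u b c.
Proof.
move=> hu hbc; apply: h; rewrite -cat_cons -[[:: u; b; c]]/([:: u] ++ [:: b; c]).
by apply: cat_subseq => //; rewrite sub1seq.
Qed.

Let W1 u w : u \in rcons cs cy -> w \in vy :: vr -> W c1 u w.
Proof.
rewrite /W /c1; case: cs h => [|c l] h' /=.
  by rewrite inE => /eqP-> _; rewrite turn_ppq.
rewrite inE => /orP[/eqP->|hu] hw; first by rewrite turn_ppq.
apply/ltW/h'; apply: subseq_trans (subseq_cons _ _); rewrite /= eqxx.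
by apply: (@cat_subseq _ [:: u] [:: w]); rewrite sub1seq.
Qed.

Let W1cy u : u \in rcons cs cy -> W c1 u cy.
Proof.
rewrite /W /c1; case: cs h => [|c l] h' /=.
  by rewrite inE => /eqP->; rewrite turn_ppq.
rewrite inE => /orP[/eqP->|]; first by rewrite turn_ppq.
rewrite mem_rcons inE => /orP[/eqP->|hu]; first by rewrite turn_pqq.
apply/ltW/h'; apply: subseq_trans (subseq_cons _ _); rewrite /= eqxx cat_rcons.
by apply: (@cat_subseq _ [:: u] [:: cy]); rewrite sub1seq // inE eqxx.
Qed.

Let W0vy w : w \in vy :: vr -> W v0 vy w.
Proof.
rewrite inE => /orP[/eqP->|hw]; first by rewrite /W turn_pqq.
by apply/ltW/T1; rewrite ?inE ?eqxx //= eqxx sub1seq.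
Qed.

Let W1vy w : w \in vy :: vr -> W c1 vy w.
Proof.
rewrite inE => /orP[/eqP->|hw]; first by rewrite /W turn_pqq.
by apply/ltW/T1; rewrite ?inE ?c1_cs ?orbT //= eqxx sub1seq.
Qed.

Let Wvy b c : subseq [:: b; c] (vy :: vr) -> W vy b c.
Proof.
rewrite /= /W; case: eqP => [->|_ bc]; first by rewrite turn_ppq.
apply/ltW/h; rewrite -[[:: vy; b; c]]/([::] ++ [:: vy; b; c]) -cat_cons.
by apply: cat_subseq; rewrite ?sub0seq //= eqxx.
Qed.

Let W01 : W v0 c1 cy.
Proof.
rewrite /W; move: c1_cs; rewrite mem_rcons inE => /orP[/eqP->|/T0cy/ltW//].
by rewrite turn_pqq.
Qed.

Let cy_cs : cy \in rcons cs cy. Proof. by rewrite mem_rcons inE eqxx. Qed.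
Let vy_ws : vy \in vy :: vr. Proof. by rewrite inE eqxx. Qed.

(** [turn] is affine in each argument, so at the midpoints of the crossed edges its sign follows
    from the signs of triples of vertices. *)
Lemma chord_neg : let c := chord (mix (1 / 2) (pos v0) (pos c1)) (mix (1 / 2) (pos cy) (pos vy)) in
  forall u, u \in rcons cs cy -> ev c (pos u) < 0.
Proof.
move=> c u hu; rewrite ev_chord turn_mix !turn_mix2.
have a1 : 0 <= turn (pos v0) (pos u) (pos cy).
  by move: hu; rewrite mem_rcons inE => /orP[/eqP->|/T0cy/ltW//]; rewrite turn_pqq.
have a2 := T0 hu vy_ws; have a3 := W1cy hu; have a4 := W1 hu vy_ws.
rewrite !(turn_swap _ (pos cy)) !(turn_swap _ (pos vy)).
by move: a1 a2 a3 a4; rewrite /T /W; lra.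
Qed.

Lemma chord_pos : let c := chord (mix (1 / 2) (pos v0) (pos c1)) (mix (1 / 2) (pos cy) (pos vy)) in
  forall u, u \in v0 :: vy :: vr -> 0 < ev c (pos u).
Proof.
move=> c u; rewrite ev_chord turn_mix !turn_mix2 [_ \in v0 :: _]inE => /orP[/eqP->|hu].
  rewrite !turn_pqp -!(turn_rot (pos v0)).
  by have := W01; have := T0 c1_cs vy_ws; rewrite /T /W; lra.
have := T0 cy_cs hu; have := W0vy hu; have := W1 cy_cs hu; have := W1vy hu.
by rewrite /T /W; lra.
Qed.

Variables (pos' : V + bool -> point) (t s : R).
Hypotheses (pos'E : forall v, v \in v0 :: vy :: vr -> pos' (inl v) = pos v)
  (pX : pos' (inr true) = mix t (pos v0) (pos c1))
  (pY : pos' (inr false) = mix s (pos cy) (pos vy)) (t01 : 0 < t < 1) (s01 : 0 < s < 1).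

(** By affinity, each triple with new vertices is a combination of old triples with nonnegative
    values, at least one of them positive. *)
Lemma convex_split :
  convex_cycle pos' [:: inl v0, inr true, inr false & map inl (vy :: vr)].
Proof.
have [/andP[t0 t1] /andP[s0 s1]] := (t01, s01).
have mix_pos (r a b : R) : 0 < r -> 0 <= a -> 0 < b -> r < 1 -> 0 < (1 - r) * a + r * b.
  by move=> r0 a0 b0 r1; rewrite ltr_wpDl ?mulr_ge0 ?mulr_gt0 //; lra.
have mix_pos2 (r a b : R) : 0 < r -> 0 < a -> 0 <= b -> r < 1 -> 0 < (1 - r) * a + r * b.
  by move=> r0 a0 b0 r1; rewrite ltr_wpDr ?mulr_ge0 ?mulr_gt0 //; lra.
have inj : injective (@inl V bool) by move=> ? ? [].
have inws (a : V + bool) : a \in map inl (vy :: vr) -> exists2 w, a = inl w & w \in vy :: vr.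
  by move=> /mapP[w ? ->]; exists w.
have P0 : pos' (inl v0) = pos v0 by rewrite pos'E // inE eqxx.
have Pw w : w \in vy :: vr -> pos' (inl w) = pos w.
  by move=> hw; rewrite pos'E // inE hw orbT.
have insub (b c : V + bool) : subseq [:: b; c] (map inl (vy :: vr)) -> exists b' c',
    [/\ b = inl b', c = inl c', subseq [:: b'; c'] (vy :: vr),
     b' \in vy :: vr & c' \in vy :: vr].
  move=> hbc; have /inws[b' bE hb] : b \in map inl (vy :: vr).
    by apply: (mem_subseq hbc); rewrite inE eqxx.
  have /inws[c' cE hc] : c \in map inl (vy :: vr).
    by apply: (mem_subseq hbc); rewrite !inE eqxx orbT.
  exists b', c'; split => //; move: hbc; rewrite bE cE => /subseqP[m sm hm].
  by apply/subseqP; exists m; [rewrite sm size_map | apply: (inj_map inj); rewrite map_mask].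
have in1 (c : V + bool) : subseq [:: c] (map inl (vy :: vr)) -> exists2 c', c = inl c' & c' \in vy :: vr.
  by rewrite sub1seq => /inws.
have v0_in : v0 \in v0 :: rcons cs cy by rewrite inE eqxx.
have c1_in : c1 \in v0 :: rcons cs cy by rewrite inE c1_cs orbT.
have cy_in : cy \in v0 :: rcons cs cy by rewrite inE cy_cs orbT.
move=> a b c; case/subseq_consP => [[->]|].
  case/subseq_consP => [[->]|].
    case/subseq_consP => [[-> _]|].
      rewrite P0 pX pY turn_mix2 turn_ppq mulr0 add0r turn_mix3.
      by rewrite mulr_gt0 //; apply: (@mix_pos) => //; apply: T0.
    move=> /in1[w -> hw]; rewrite P0 pX Pw // turn_mix2 turn_ppq mulr0 add0r.
    by rewrite mulr_gt0 //; apply: T0.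
  case/subseq_consP => [[-> /in1[w -> hw]]|].
    by rewrite P0 pY Pw // turn_mix2; apply: (@mix_pos2) => //; [apply: T0 | apply: W0vy].
  by move=> /insub[b' [c' [-> -> hbc hb hc]]]; rewrite P0 !Pw //; apply: T1.
case/subseq_consP => [[->]|].
  case/subseq_consP => [[-> /in1[w -> hw]]|].
    rewrite pX pY Pw // turn_mix !turn_mix2; apply: (@mix_pos2) => //.
      by apply: (@mix_pos2) => //; [apply: T0 | apply: W0vy].
    by apply: addr_ge0; apply: mulr_ge0; try lra; [apply: W1 | apply: W1vy].
  move=> /insub[b' [c' [-> -> hbc hb hc]]]; rewrite pX !Pw // turn_mix.
  by apply: (@mix_pos) => //; [apply/ltW/T1 | apply: T1].
case/subseq_consP => [[-> /insub[b' [c' [-> -> hbc hb hc]]]]|].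
  by rewrite pY !Pw // turn_mix; apply: (@mix_pos2) => //; [apply: T1 | apply: Wvy].
move=> habc.
have [[a' aE ha] [b' bE hb] [c' cE hc]] : [/\ exists2 w, a = inl w & w \in vy :: vr,
    exists2 w, b = inl w & w \in vy :: vr & exists2 w, c = inl w & w \in vy :: vr].
  by split; apply/inws/(mem_subseq habc); rewrite !inE eqxx ?orbT.
rewrite aE bE cE !Pw //; apply: h.
have sub : subseq [:: a'; b'; c'] (vy :: vr).
  move: habc; rewrite aE bE cE => /subseqP[m sm hm].
  by apply/subseqP; exists m; [rewrite sm size_map | apply: (inj_map inj); rewrite map_mask].
by apply: subseq_trans sub _; rewrite -cat_cons suffix_subseq.
Qed.

End Orientation.

End Geometry.

(** * Reachable polytopes *)

Local Open Scope nat_scope.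

(** The same [e1], [e2] serve throughout, because cuts only put new outer vertices on existing outer
    edges. *)
Record config (R : realType) (V F : finType) (inc : V -> F -> bool) (F0 : F) (rg : seq (V * F))
    (ds : seq F) (Z : option F) : Prop := Config {
  config_simple : simple_inc inc;
  config_ringed : ringed inc F0 rg ds;
  config_flag : flag_but inc F0 Z;
  config_real : exists (pos : V -> 'rV[R]_3) (l : F -> 'rV[R]_3 * R) (e1 e2 : 'rV[R]_3),
    realizes inc pos l /\ convex_cycle e1 e2 pos (map fst rg) }.

Lemma config_chord R (V F : finType) (inc : V -> F -> bool) F0 v0 x lM cy y lr ds Z Z' :
  lr != [::] -> config R inc F0 ((v0, x) :: lM ++ (cy, y) :: lr) ds Z -> chord_mode x lM Z Z' ->
  config R (split_inc inc F0 x y (cut_set cy lM)) (Some F0) (new_ring x y v0 lr)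
    (new_done lM ds) Z'.
Proof.
move=> lr0 [simp rd fl [pos [l [e1 [e2 [rl cc]]]]]] mode.
have ct := ring_cut lr0 rd.
split; [exact: split_simple simp ct | exact: (new_ringed lr0 rd) | exact: (new_flag lr0 rd mode fl) |].
have [vy [vr lrE]] : exists vy vr, map fst lr = vy :: vr.
  by case: (lr) lr0 => // -[v f] l' _; exists v, (map fst l').
have nextE : cut_next v0 lr = vy by rewrite /cut_next lrE.
have ringE : map fst ((v0, x) :: lM ++ (cy, y) :: lr) = v0 :: rcons (map fst lM) cy ++ vy :: vr.
  by rewrite /= map_cat /= cat_rcons lrE.
rewrite ringE in cc; rewrite nextE in ct.
have [|pos' [l' [t [s [rl' old t01 s01 [pX pY]]]]]] :=
  split_realizes simp ct rl (fun v => @chord_neg R e1 e2 V pos v0 cy vy _ vr cc v).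
  move=> v vF nC; apply: (chord_pos cc).
  rewrite (ringed_memv rd) ringE in_cons mem_cat in vF; case/or3P: vF => [/eqP->|vC|hv].
  - by rewrite inE eqxx.
  - by rewrite /cut_set vC in nC.
  - by rewrite in_cons hv orbT.
exists pos', l', e1, e2; split=> //.
rewrite /new_ring /= lift_fst lrE.
apply: (convex_split cc _ pX pY t01 s01) => v hv; apply: old.
have := ringed_uniqv rd; rewrite ringE cons_uniq cat_uniq mem_cat negb_or.
move=> /andP[/andP[n0 _] /and3P[_ /hasPn h _]].
by move: hv; rewrite inE => /orP[/eqP->//|/h].
Qed.

Section Sizes.
Variables (R : realType) (V F : finType) (inc : V -> F -> bool) (F0 : F) (Z : option F).
Variables (v0 cy : V) (x y : F) (lM lr : seq (V * F)) (ds : seq F).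
Hypothesis cf : config R inc F0 ((v0, x) :: lM ++ (cy, y) :: lr) ds Z.

Let inc' := split_inc inc F0 x y (cut_set cy lM).

Let uniq_all : uniq (F0 :: x :: y :: map snd lM ++ map snd lr ++ ds).
Proof.
have := ringed_uniqf (config_ringed cf); rewrite (@perm_uniq _ _
  [:: F0, x, y & map snd lM ++ map snd lr ++ ds]) //.
rewrite /= map_cat -catA /= !perm_cons.
exact: (permEl (perm_catCA (map snd lM) [:: y] _)).
Qed.

Let same f : f != F0 -> f != x -> f != y -> fsize inc' (Some f) = fsize inc f.
Proof. by move=> fF fx fy; rewrite split_fsize_old // (negbTE fx) (negbTE fy) !addn0. Qed.

Let same_map s : {subset s <= map snd lM ++ map snd lr ++ ds} ->
  map (fsize inc') (map Some s) = map (fsize inc) s.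
Proof.
move=> sub; rewrite -map_comp; apply/eq_in_map => f /sub hf /=.
apply: same; apply: contraTneq uniq_all => e; subst f; rewrite /= !inE.
- by rewrite hf !orbT.
- by rewrite hf !orbT andbF.
- by rewrite hf !andbF.
Qed.

Lemma new_ring_sizes : map (fsize inc') (map snd (new_ring x y v0 lr)) =
  [:: (fsize inc x).+1, size lM + 3, (fsize inc y).+1 & map (fsize inc) (map snd lr)].
Proof.
have [/andP[xF yF] xy] : (x != F0) && (y != F0) /\ x != y.
  move: uniq_all; rewrite /= !inE !negb_or (eq_sym F0) (eq_sym F0).
  by move=> /andP[/and3P[-> -> _] /andP[/andP[-> _] _]].
rewrite /= lift_snd same_map; last by move=> f; rewrite !mem_cat => ->; rewrite orbT.
rewrite !split_fsize_old // split_fsize_new !eqxx (negbTE xy) eq_sym (negbTE xy) addn0 !addn1 addn0.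
congr [:: _, _, _ & _].
have : uniq (rcons (map fst lM) cy).
  have := ringed_uniqv (config_ringed cf); rewrite /= map_cat /= -cat_rcons cat_uniq.
  by move=> /and3P[_ ].
move=> /card_uniqP; rewrite size_rcons size_map.
rewrite (_ : #|rcons _ _| = #|cut_set cy lM|) => [->|]; first by rewrite addSnnS.
by apply: eq_card => v; rewrite !unfold_in.
Qed.

Lemma new_done_sizes : map (fsize inc') (new_done lM ds) =
  map (fsize inc) (map snd lM) ++ map (fsize inc) ds.
Proof.
rewrite /new_done same_map ?map_cat // => f; rewrite !mem_cat.
by case/orP => ->; rewrite ?orbT.
Qed.

End Sizes.

Lemma config_rot R (V F : finType) (inc : V -> F -> bool) F0 u v ds Z :
  config R inc F0 (u ++ v) ds Z -> config R inc F0 (v ++ u) ds Z.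
Proof.
move=> [simp [rg uv mv uf mf] fl [pos [l [e1 [e2 [rl cc]]]]]].
have pvu : perm_eq (v ++ u) (u ++ v) by rewrite perm_catC.
have pf : perm_eq (F0 :: map snd (v ++ u) ++ ds) (F0 :: map snd (u ++ v) ++ ds).
  by rewrite perm_cons perm_cat2r perm_map.
split=> //; last first.
  exists pos, l, e1, e2; split => //; rewrite !map_cat in cc *; exact: (convex_rot cc).
split.
- case: u v rg {uv mv uf mf fl cc pvu pf} => [|c u] [|d v]; rewrite ?cats0 //.
  move=> /ring_cat[h1 h2]; apply/ring_cat.
  by move: h1 h2; rewrite !map_cat !last_cat.
- by rewrite (perm_uniq (perm_map fst pvu)).
- by move=> w; rewrite (perm_mem (perm_map fst pvu)).
- by rewrite (perm_uniq pf).
- by move=> f; rewrite (perm_mem pf).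
Qed.

(* [w]: sizes of the facets around a distinguished facet, [D]: sizes (except 6) of the facets not
   adjacent to it; [b] tells whether flagness may fail along the first facet of the ring *)
Inductive state (R : realType) (b : bool) (w D : seq nat) : Prop :=
  State (V F : finType) (inc : V -> F -> bool) (F0 : F) (rg : seq (V * F)) (ds : seq F) of
    config R inc F0 rg ds (if b then Some (head F0 (map snd rg)) else None) &
    map (fsize inc) (map snd rg) = w & perm_eq (non6 (map (fsize inc) ds)) D.

Section States.
Variable R : realType.

Lemma state_perm b w D D' : state R b w D -> perm_eq D D' -> state R b w D'.
Proof.
by case=> V F inc F0 rg ds cf wE pD pDD'; apply: (State cf) => //; apply: perm_trans pD pDD'.
Qed.

Lemma map_split (A B : Type) (f : A -> B) s u v : map f s = u ++ v ->
  exists s1 s2, [/\ s = s1 ++ s2, map f s1 = u & map f s2 = v].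
Proof.
move=> e; exists (take (size u) s), (drop (size u) s).
by rewrite cat_take_drop map_take map_drop e take_size_cat ?drop_size_cat.
Qed.

Lemma state_rot u v D : state R false (u ++ v) D -> state R false (v ++ u) D.
Proof.
case=> V F inc F0 rg ds cf; rewrite -map_comp => /map_split[s1 [s2 [rgE <- <-]]] pD.
apply: (@State R _ _ _ V F inc F0 (s2 ++ s1) ds).
- by apply: config_rot; rewrite -rgE.
- by rewrite -map_cat -map_comp.
- by [].
Qed.

Lemma state_chord_data b x M y r D : state R b (x :: M ++ y :: r) D ->
  exists (V F : finType) (inc : V -> F -> bool) (F0 : F) v0 f lM cy g lr ds,
  [/\ config R inc F0 ((v0, f) :: lM ++ (cy, g) :: lr) ds (if b then Some f else None),
      [/\ fsize inc f = x, map (fsize inc) (map snd lM) = M, fsize inc g = y &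
      map (fsize inc) (map snd lr) = r] & perm_eq (non6 (map (fsize inc) ds)) D].
Proof.
case=> V F inc F0 [|[v0 f] rg] ds //= cf [fE]; rewrite -map_comp.
move=> /map_split[lM [[|[cy g] lr] [rgE ME //= [gE lrE]]]] pD.
rewrite rgE in cf.
by exists V, F, inc, F0, v0, f, lM, cy, g, lr, ds; split=> //; split; rewrite // -map_comp.
Qed.

Lemma state_cover x M y r D : M != [::] -> r != [::] -> state R false (x :: M ++ y :: r) D ->
  state R false [:: x.+1, size M + 3, y.+1 & r] (non6 M ++ D).
Proof.
move=> M0 r0 /state_chord_data[V [F [inc [F0 [v0 [f [lM [cy [g [lr [ds [cf [fE ME gE lrE] pD]]]]]]]]]]]].
have lr0 : lr != [::] by case: (lr) lrE r0 => //= <-.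
have lM0 : lM != [::] by case: (lM) ME M0 => //= <-.
have cf' := config_chord lr0 cf (Or31 _ _ (And3 lM0 erefl erefl)).
apply: (@State R false _ _ _ _ _ _ _ _ cf').
- by rewrite (new_ring_sizes cf) fE gE lrE -ME !size_map.
- by rewrite (new_done_sizes cf) /non6 filter_cat ME perm_cat2l.
Qed.

Lemma state_truncate b z y r D : r != [::] -> state R b [:: z, y & r] D ->
  state R true [:: z.+1, 3, y.+1 & r] D.
Proof.
move=> r0 st; have := @state_chord_data b z [::] y r D st.
move=> [V [F [inc [F0 [v0 [f [lM [cy [g [lr [ds [cf [fE ME gE lrE] pD]]]]]]]]]]]].
have lr0 : lr != [::] by case: (lr) lrE r0 => //= <-.
have lM0 : lM = [::] by case: (lM) ME.
subst lM.
have mode : chord_mode f ([::] : seq (V * F)) (if b then Some f else None) (Some (Some f)).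
  by constructor 2; split=> //; case: (b); [right | left].
have cf' := config_chord lr0 cf mode.
apply: (@State R true _ _ _ _ _ _ _ _ cf').
- by rewrite (new_ring_sizes cf) fE gE lrE.
- by rewrite (new_done_sizes cf).
Qed.

(** [z] is the side along which flagness may fail; the chord joins its two neighbours on the ring,
    the last facet [x] and [t]. *)
Lemma state_uncover x z t r D : r != [::] -> state R true (z :: t :: r ++ [:: x]) D ->
  state R false [:: x.+1, 4, t.+1 & r] (non6 [:: z] ++ D).
Proof.
move=> r0 [V F inc F0 rg ds].
case: rg => [//|[c g] [|[cy h] rg]] /= cf; first by case.
move=> [gE hE].
rewrite -map_comp => /map_split[lr [l1 [rgE lrE l1E]]] pD.
case: l1 rgE l1E => [//|[v0 f] l1] rgE /= [fE /eqP].
rewrite -size_eq0 size_map size_eq0 => /eqP l1E; subst l1.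
have cf0 : config R inc F0 ([:: (v0, f)] ++ [:: (c, g), (cy, h) & lr]) ds (Some g).
  by apply: config_rot; rewrite /= -rgE.
have lr0 : lr != [::] by case: (lr) lrE r0 => //= <-.
have mode : chord_mode f [:: (c, g)] (Some g) None by constructor 3; exists c, g.
have cf' := @config_chord R V F inc F0 v0 f [:: (c, g)] cy h lr ds _ _ lr0 cf0 mode.
apply: (@State R false _ _ _ _ _ _ _ _ cf').
- rewrite (@new_ring_sizes R V F inc F0 _ v0 cy f h [:: (c, g)] lr ds cf0) fE hE.
  by rewrite -map_comp lrE.
- rewrite (@new_done_sizes R V F inc F0 _ v0 cy f h [:: (c, g)] lr ds cf0).
  by rewrite /non6 filter_cat [map snd _]/= [map _ [:: g]]/= gE perm_cat2l.
Qed.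

Lemma state_truncations b j z y r D : r != [::] -> state R b [:: z, y & r] D ->
  state R true (z + j.+1 :: 3 :: nseq j 4 ++ y.+1 :: r) D.
Proof.
move=> r0 st; elim: j => [|j IH]; first by rewrite addn1; apply: state_truncate st.
by rewrite addnS; apply: (@state_truncate true) IH; case: (j).
Qed.

(** For [j > 0], each vertex cut enlarges [z] and turns the preceding triangle into a quadrangle;
    the final chord covers [z] and removes the defect of flagness. *)
Lemma state_fan x z y j r D : r != [::] -> state R false [:: x, z, y & r] D ->
  state R false (x.+1 :: nseq j.+1 4 ++ y.+1 :: r) (non6 [:: z + j] ++ D).
Proof.
case: j => [|j] r0 st.
  by rewrite addn0; apply: (@state_cover x [:: z] y r D isT r0).
have := @state_rot [:: x] [:: z, y & r] D st; rewrite /= => st1.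
have st2 := @state_truncations _ j _ _ _ _ (cat_nil_l _ r0) st1.
have := @state_uncover x (z + j.+1) 3 (nseq j 4 ++ y.+1 :: r) D; apply.
  exact: cat_nil_r.
by rewrite -catA; exact: st2.
Qed.

Lemma state_steps w E w' D : steps w E w' -> state R false w D -> state R false w' (E ++ D).
Proof.
move=> st s0; elim: st => {E w'} //.
- by move=> E E' w' _ IH pE; apply: state_perm IH _; rewrite perm_cat2r.
- by move=> E u v _; apply: state_rot.
- by move=> E x M y r _ IH M0 r0; rewrite -catA; apply: state_cover.
- by move=> E x z y j r _ IH r0; rewrite -catA; apply: state_fan.
Qed.

(** After [n - 3] vertex cuts along a side of the outer triangle, covering that side gives the
    prism: the side itself is one [n]-gon, the outer facet the other. *)
Lemma state_prism n : 3 < n -> state R true [:: 3; 3; 3] [::] ->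
  state R false (nseq n 4) (non6 [:: n]).
Proof.
case: n => [|[|[|[|n]]]] // _ st.
have st1 := @state_truncations true n 3 3 [:: 3] [::] isT st.
have e : nseq n.+4 4 = [:: 4, 4, 4 & nseq n 4 ++ [:: 4]] by rewrite fours_cat cats0.
rewrite e -[non6 _]cats0 -[n.+4]/(3 + n.+1).
apply: state_uncover; first by case: (n).
by rewrite -catA; exact: st1.
Qed.

End States.

(** * From incidences back to polytopes *)

Local Open Scope ring_scope.

Section Ranks.
Variable R : realType.
Implicit Types d a : 'rV[R]_3.

Lemma dotBr d a a' : dot d (a - a') = dot d a - dot d a'.
Proof. by rewrite dotDr -scaleN1r dotZr mulN1r. Qed.

Lemma mul_dot d a : d *m a^T = (dot d a)%:M.
Proof. by rewrite /dot -mx11_scalar. Qed.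

(** The pairings with [a1], [a2] form a triangular matrix with nonzero diagonal. *)
Lemma rank_two d1 d2 a1 a2 : dot d1 a2 = 0 -> dot d1 a1 != 0 -> dot d2 a2 != 0 ->
  \rank (col_mx d1 d2) = 2%N.
Proof.
move=> h12 h11 h22; apply/eqP; rewrite eqn_leq rank_leq_row /=.
apply: leq_trans (mxrankM_maxl _ (row_mx a1^T a2^T)).
rewrite mxrank_unit // mul_col_row !mul_dot h12 raddf0 unitmxE det_lblock !det_scalar1.
by rewrite unitfE mulf_neq0.
Qed.

Lemma rank_three d1 d2 d3 a1 a2 a3 : dot d1 a2 = 0 -> dot d1 a3 = 0 -> dot d2 a3 = 0 ->
  dot d1 a1 != 0 -> dot d2 a2 != 0 -> dot d3 a3 != 0 ->
  \rank (col_mx d1 (col_mx d2 d3)) = 3%N.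
Proof.
move=> h12 h13 h23 h11 h22 h33; apply/eqP; rewrite eqn_leq rank_leq_row /=.
apply: leq_trans (mxrankM_maxl _ (row_mx a1^T (row_mx a2^T a3^T))).
rewrite mxrank_unit // mul_col_row mul_mx_row !mul_dot h12 h13 raddf0 row_mx0.
rewrite mul_col_row !mul_dot h23 raddf0 unitmxE !det_lblock !det_scalar1.
by rewrite unitfE !mulf_neq0.
Qed.

(** [p] and [q] show that [a1], [a2] are independent; two orthogonal planes do not fit into
    dimension 3. *)
Lemma rank_two_orth d1 d2 a1 a2 p q : \rank (col_mx d1 d2) = 2%N ->
  dot d1 a1 = 0 -> dot d1 a2 = 0 -> dot d2 a1 = 0 -> dot d2 a2 = 0 ->
  dot p a2 = 0 -> dot p a1 != 0 -> dot q a2 != 0 -> False.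
Proof.
move=> rk h11 h12 h21 h22 p2 p1 q2.
have rka : \rank (row_mx a1^T a2^T) = 2%N.
  apply/eqP; rewrite eqn_leq rank_leq_col /=.
  apply: leq_trans (mxrankM_maxr (col_mx p q) _).
  rewrite mxrank_unit // mul_col_row !mul_dot p2 raddf0 unitmxE det_lblock !det_scalar1.
  by rewrite unitfE mulf_neq0.
have := @mulmx0_rank_max _ _ _ _ (col_mx d1 d2) (row_mx a1^T a2^T).
rewrite rk rka mul_col_row !mul_dot h11 h12 h21 h22 !raddf0 => h.
by have := h (block_mx0 _ _ _ _ _); rewrite ltnn.
Qed.

Lemma rank_three_orth d1 d2 d3 a : \rank (col_mx d1 (col_mx d2 d3)) = 3%N ->
  dot d1 a = 0 -> dot d2 a = 0 -> dot d3 a = 0 -> a = 0.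
Proof.
move=> rk h1 h2 h3; have := @mulmx0_rank_max _ _ _ _ (col_mx d1 (col_mx d2 d3)) a^T.
rewrite rk !mul_col_mx !mul_dot h1 h2 h3 !raddf0 !col_mx0 => /(_ erefl).
by rewrite -[X in (_ <= X)%N]addn0 leq_add2l leqn0 mxrank_tr mxrank_eq0 => /eqP.
Qed.

End Ranks.

Section Realization.
Variables (R : realType) (V F : finType) (inc : V -> F -> bool).
Variables (pos : V -> 'rV[R]_3) (l : F -> 'rV[R]_3 * R).
Hypotheses (simp : simple_inc inc) (rl : realizes inc pos l).

Let ge0 v f : 0 <= ev (l f) (pos v). Proof. by case: (rl v f). Qed.
Let eq0 v f : (ev (l f) (pos v) == 0) = inc v f. Proof. by case: (rl v f). Qed.

Let dot_dir u v f : inc v f -> dot (pos u - pos v) (l f).1 = - ev (l f) (pos u).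
Proof. by rewrite -eq0 dotBl /ev => /eqP h; rewrite opprB; lra. Qed.

Lemma vertex_frame v f : inc v f -> exists g h wf wg wh,
  [/\ uniq [:: f; g; h], forall k, inc v k = (k \in [:: f; g; h]),
     [/\ inc wf g, inc wf h & ~~ inc wf f], [/\ inc wg f, inc wg h & ~~ inc wg g] &
     [/\ inc wh f, inc wh g & ~~ inc wh h]].
Proof.
move=> vf; have [g [h [u E]]] := three_other simp vf.
have vg : inc v g by rewrite E !inE eqxx orbT.
have vh : inc v h by rewrite E !inE eqxx !orbT.
have [fg fh gh] : [/\ f != g, f != h & g != h].
  by move: u; rewrite /= !inE negb_or andbT => /andP[/andP[-> ->] ->].
have edge a b c : a != b -> inc v a -> inc v b ->
    (forall k, inc v k -> k != a -> k != b -> k = c) ->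
    exists w, [/\ inc w a, inc w b & ~~ inc w c].
  move=> ab va vb H; have [w [k [wa wb vk nwk]]] := simple_edge simp ab va vb.
  exists w; split=> //; rewrite -(H k) //; first by apply: contraNneq nwk => ->.
  by apply: contraNneq nwk => ->.
have [|wf Hf] := edge g h f gh vg vh.
  by move=> k; rewrite E !inE => /or3P[]/eqP-> // ; rewrite eqxx.
have [|wg Hg] := edge f h g fh vf vh.
  by move=> k; rewrite E !inE => /or3P[]/eqP-> // ; rewrite eqxx.
have [|wh Hh] := edge f g h fg vf vg.
  by move=> k; rewrite E !inE => /or3P[]/eqP-> // ; rewrite eqxx.
by exists g, h, wf, wg, wh.
Qed.

Let posn (i : 'I_#|V|) : 'rV[R]_3 := pos (enum_val i).

Definition facet_set (f : F) : {set 'I_#|V|} := [set i | inc (enum_val i) f].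

Let dot_le v f : dot (pos v) (l f).1 <= (l f).2.
Proof. by have := ge0 v f; rewrite /ev subr_ge0. Qed.

Let dot_eq v f : (dot (pos v) (l f).1 == (l f).2) = inc v f.
Proof. by rewrite -eq0 /ev subr_eq0 eq_sym. Qed.

Let neg_dir u v f : inc v f -> ~~ inc u f -> dot (pos u - pos v) (l f).1 != 0.
Proof. by move=> vf; rewrite dot_dir // oppr_eq0 eq0. Qed.

Let zero_dir u v f : inc v f -> inc u f -> dot (pos u - pos v) (l f).1 = 0.
Proof. by move=> vf uf; rewrite dot_dir //; move: uf; rewrite -eq0 => /eqP->; rewrite oppr0. Qed.

Lemma facet_set_facet f : is_facet posn (facet_set f).
Proof.
have [v vf] := simple_facet simp f.
have [g [h [wf [wg [wh [u E [wfg wfh nwf] [wgf wgh nwg] [whf whg nwh]]]]]]] := vertex_frame vf.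
have vg : inc v g by rewrite E !inE eqxx orbT.
have vh : inc v h by rewrite E !inE eqxx !orbT.
split.
  exists (l f).1, (l f).2; split.
    apply: contraTneq (neg_dir vf nwf) => ->.
    by rewrite negbK /dot trmx0 mulmx0 mxE.
  split=> [i|]; first exact: dot_le.
  by apply/setP => i; rewrite !inE dot_eq.
exists (enum_rank v), (enum_rank wg), (enum_rank wh); split; rewrite ?inE ?enum_rankK //.
rewrite /posn !enum_rankK.
apply: (@rank_two _ _ _ (l g).1 (l h).1); by [apply: zero_dir | apply: neg_dir].
Qed.

(** At a simple vertex the three normals are dual, up to negative factors, to the three edge
    directions, and a functional maximal at [v] does not increase along these. *)
Lemma frame_coords v f g h wf wg wh a :
  [/\ inc v f, inc v g & inc v h] ->
  [/\ inc wf g, inc wf h & ~~ inc wf f] -> [/\ inc wg f, inc wg h & ~~ inc wg g] ->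
  [/\ inc wh f, inc wh g & ~~ inc wh h] ->
  (forall u, dot (pos u) a <= dot (pos v) a) ->
  exists cf cg ch, [/\ 0 <= cf, 0 <= cg, 0 <= ch &
    a = cf *: (l f).1 + cg *: (l g).1 + ch *: (l h).1].
Proof.
move=> [vf vg vh] [wfg wfh nwf] [wgf wgh nwg] [whf whg nwh] amax.
pose c w k := dot (pos w - pos v) a / dot (pos w - pos v) (l k).1.
have c0 w k : inc v k -> ~~ inc w k -> 0 <= c w k.
  move=> vk nwk; rewrite /c dot_dir // invrN mulrN -mulNr divr_ge0 // dotBl.
  by rewrite opprB subr_ge0.
exists (c wf f), (c wg g), (c wh h); split; rewrite ?c0 //.
apply/eqP; rewrite -subr_eq0; apply/eqP.
apply: (@rank_three_orth _ (pos wf - pos v) (pos wg - pos v) (pos wh - pos v)).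
- apply: (@rank_three _ _ _ _ (l f).1 (l g).1 (l h).1); by [apply: zero_dir | apply: neg_dir].
- rewrite dotBr !dotDr !dotZr (zero_dir vg wfg) (zero_dir vh wfh) !mulr0 !addr0.
  by rewrite /c divfK ?neg_dir // subrr.
- rewrite dotBr !dotDr !dotZr (zero_dir vf wgf) (zero_dir vh wgh) !mulr0 !addr0 add0r.
  by rewrite /c divfK ?neg_dir // subrr.
- rewrite dotBr !dotDr !dotZr (zero_dir vf whf) (zero_dir vg whg) !mulr0 !add0r.
  by rewrite /c divfK ?neg_dir // subrr.
Qed.

(** Expanded at a vertex of [S], the supporting functional shows that [S] is the intersection of the
    facets with nonzero coefficient. Two such coefficients would confine [S] to a line, against its
    rank. *)
Lemma facet_is_set S : is_facet posn S -> exists f, S = facet_set f.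
Proof.
case=> [[a [b [a0 [ab SE]]]] [i0 [i1 [i2 [i0S i1S i2S rk]]]]].
pose v := enum_val i0.
have [p [q [r [_ E0]]]] := simple_three simp v.
have [f [vf]] : exists f, inc v f /\ True by exists p; rewrite E0 inE eqxx.
move=> _; have [g [h [wf [wg [wh [u E Hf Hg Hh]]]]]] := vertex_frame vf.
have vg : inc v g by rewrite E !inE eqxx orbT.
have vh : inc v h by rewrite E !inE eqxx !orbT.
have vb : dot (pos v) a = b by move: i0S; rewrite SE inE => /eqP.
have amax w : dot (pos w) a <= dot (pos v) a.
  by have := ab (enum_rank w); rewrite /posn enum_rankK vb.
have [cf [cg [ch [cf0 cg0 ch0 aE]]]] := frame_coords (And3 vf vg vh) Hf Hg Hh amax.
have slack w : b - dot (pos w) a = cf * ev (l f) (pos w) + cg * ev (l g) (pos w) + ch * ev (l h) (pos w).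
  have e k : inc v k -> dot (pos v) (l k).1 = (l k).2 by rewrite -dot_eq => /eqP.
  rewrite -vb aE !dotDr !dotZr (e f vf) (e g vg) (e h vh) /ev; ring.
have SE' i : i \in S = [&& (cf == 0) || inc (enum_val i) f, (cg == 0) || inc (enum_val i) g &
    (ch == 0) || inc (enum_val i) h].
  rewrite SE inE eq_sym -subr_eq0 slack !paddr_eq0 ?addr_ge0 ?mulr_ge0 //.
  by rewrite !mulf_eq0 !eq0 andbA.
have two k1 k2 w1 w2 : [/\ inc v k1, inc v k2, inc w1 k2, ~~ inc w1 k1 & ~~ inc w2 k2] ->
    (forall i, i \in S -> inc (enum_val i) k1 && inc (enum_val i) k2) -> False.
  move=> [v1 v2 w12 n11 n22] sub.
  have /andP[i11 i12] := sub _ i1S; have /andP[i21 i22] := sub _ i2S.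
  apply: (@rank_two_orth _ _ _ (l k1).1 (l k2).1 (pos w1 - pos v) (pos w2 - pos v) rk);
  by [apply: zero_dir | apply: neg_dir].
case: Hf Hg Hh => [wfg wfh nwf] [wgf wgh nwg] [whf whg nwh].
have [f0|f0] := eqVneq cf 0; have [g0|g0] := eqVneq cg 0; have [h0|h0] := eqVneq ch 0.
- by move: a0; rewrite aE f0 g0 h0 !scale0r !addr0 eqxx.
- by exists h; apply/setP => i; rewrite SE' f0 g0 (negbTE h0) eqxx /= inE.
- by exists g; apply/setP => i; rewrite SE' f0 h0 (negbTE g0) eqxx /= inE andbT.
- case: (two g h wg wh) => // i; rewrite SE' (negbTE g0) (negbTE h0) /=.
  by move=> /and3P[_ -> ->].
- by exists f; apply/setP => i; rewrite SE' g0 h0 (negbTE f0) eqxx /= inE !andbT.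
- case: (two f h wf wh) => // i; rewrite SE' (negbTE f0) (negbTE h0) /=.
  by move=> /and3P[-> _ ->].
- case: (two f g wf wg) => // i; rewrite SE' (negbTE f0) (negbTE g0) /=.
  by move=> /and3P[-> ->].
- case: (two f g wf wg) => // i; rewrite SE' (negbTE f0) (negbTE g0) /=.
  by move=> /and3P[-> ->].
Qed.

Lemma facet_set_inj : injective facet_set.
Proof.
move=> f g /setP fg; apply/eqP/negPn/negP => nfg.
have [v vf] := simple_facet simp f.
have same w : inc w f = inc w g by have := fg (enum_rank w); rewrite !inE enum_rankK.
have [h [k [wf [wh [wk [u E _ Hh Hk]]]]]] := vertex_frame vf.
have := vf; rewrite same E !inE eq_sym (negbTE nfg) /= => /orP[] /eqP e.
  by case: Hh => hf _; rewrite -e -same hf.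
by case: Hk => hf _; rewrite -e -same hf.
Qed.

Lemma card_facet_set f : #|facet_set f| = fsize inc f.
Proof.
rewrite /fsize (reindex (@enum_val V predT)) /=; last first.
  by exists enum_rank => i _; [apply: enum_valK | apply: enum_rankK].
rewrite -[LHS]sum1_card big_mkcond /=; apply: eq_bigr => i _.
by rewrite inE; case: (inc _ _).
Qed.

Lemma pk_fsize k : pk posn k = #|[set f | fsize inc f == k]|.
Proof.
rewrite /pk -(card_imset _ facet_set_inj); apply: eq_card => S; rewrite !inE.
apply/andP/imsetP => [[/asboolP/facet_is_set[f ->] /eqP <-]|[f + ->]].
  by exists f; rewrite // inE card_facet_set.
rewrite inE card_facet_set => ->; split => //; apply/asboolP; exact: facet_set_facet.
Qed.

Lemma extract_simple : simple_polytope posn.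
Proof.
move=> i; have [p [q [r [u E]]]] := simple_three simp (enum_val i).
transitivity #|[set f | inc (enum_val i) f]|.
  rewrite -(card_imset _ facet_set_inj); apply: eq_card => S; rewrite !inE.
  apply/andP/imsetP => [[/asboolP/facet_is_set[f ->]]|[f + ->]].
    by rewrite inE => fi; exists f; rewrite // inE.
  by rewrite !inE => ->; split => //; apply/asboolP; exact: facet_set_facet.
transitivity #|[:: p; q; r]|; first by apply: eq_card => f; rewrite inE E.
by rewrite (card_uniqP u).
Qed.

Lemma extract_polytope (v0 : V) : is_polytope3 posn.
Proof.
split.
  move=> i; set v := enum_val i.
  have [f [g [h [_ E]]]] := simple_three simp v.
  have [vf vg vh] : [/\ inc v f, inc v g & inc v h] by rewrite !E !inE !eqxx !orbT.
  (* The sum of the three facet functionals at a vertex is maximal there only. *)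
  exists ((l f).1 + (l g).1 + (l h).1), ((l f).2 + (l g).2 + (l h).2); split.
    rewrite !dotDr; have e k : inc v k -> dot (posn i) (l k).1 = (l k).2 by rewrite -dot_eq => /eqP.
    by rewrite !e.
  move=> j ji; set u := enum_val j.
  have [k /andP[vk nuk]] : exists k, inc v k && ~~ inc u k.
    apply/existsP; apply: contraNT ji; rewrite negb_exists => /forallP H.
    apply/eqP/enum_val_inj/esym/(simple_inj simp) => k vk.
    by have := H k; rewrite vk negbK.
  have lt : dot (posn j) (l k).1 < (l k).2 by rewrite lt_neqAle dot_le andbT dot_eq.
  have [lf lg lh] : [/\ dot (posn j) (l f).1 <= (l f).2, dot (posn j) (l g).1 <= (l g).2 &
    dot (posn j) (l h).1 <= (l h).2] by rewrite !dot_le.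
  rewrite !dotDr; move: vk lt; rewrite E !inE => /or3P[] /eqP-> lt; lra.
have [p [q [r [_ E0]]]] := simple_three simp v0.
have v0p : inc v0 p by rewrite E0 inE eqxx.
have [g [h [wf [wg [wh [u E [wfg wfh nwf] [wgf wgh nwg] [whf whg nwh]]]]]]] := vertex_frame v0p.
have vg : inc v0 g by rewrite E !inE eqxx orbT.
have vh : inc v0 h by rewrite E !inE eqxx !orbT.
exists (enum_rank v0), (enum_rank wf), (enum_rank wg), (enum_rank wh).
rewrite /posn !enum_rankK.
apply: (@rank_three _ _ _ _ (l p).1 (l g).1 (l h).1); by [apply: zero_dir | apply: neg_dir].
Qed.

(** The slack of [g] vanishes at [x], where it is also an average of nonnegative slacks at vertices
    of [f]; a vertex of nonzero weight lies on [g]. *)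
Lemma hull_meet f g x : in_hull posn (facet_set f) x -> in_hull posn (facet_set g) x ->
  exists v, inc v f && inc v g.
Proof.
case=> w [w0 wf w1 xE] [w' [w'0 wg' w'1 xE']].
have ev_sum (z : 'I_#|V| -> R) : \sum_i z i = 1 -> x = \sum_i z i *: posn i ->
    ev (l g) x = \sum_i z i * ev (l g) (posn i).
  move=> z1 ->; rewrite /ev; under [RHS]eq_bigr do rewrite mulrBr.
  rewrite sumrB -mulr_suml z1 mul1r; congr (_ - _).
  rewrite (big_morph (fun p => dot p (l g).1) (id1 := 0) (op1 := +%R)).
  - by apply: eq_bigr => i _; rewrite dotZl.
  - by move=> p q; rewrite dotDl.
  - by rewrite /dot mul0mx mxE.
have gx : ev (l g) x = 0.
  rewrite (ev_sum _ w'1 xE'); apply: big1 => i _.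
  have [ig|/wg'->] := boolP (i \in facet_set g); last by rewrite mul0r.
  by move: ig; rewrite inE -eq0 => /eqP->; rewrite mulr0.
have [i wi] : exists i, w i != 0.
  apply/existsP; apply: contraT; rewrite negb_exists => /forallP h.
  suff : (1 : R) = 0 by move/eqP; rewrite oner_eq0.
  by rewrite -w1 big1 // => i _; apply/eqP; have := h i; rewrite negbK.
exists (enum_val i); apply/andP; split.
  have : i \in facet_set f by apply: contraNT wi => /wf->.
  by rewrite inE.
move: gx; rewrite (ev_sum _ w1 xE) => /eqP; rewrite psumr_eq0; last first.
  by move=> j _; exact: mulr_ge0 (w0 j) (ge0 _ _).
move=> /allP/(_ i); rewrite mem_index_enum => /(_ isT) /=.
by rewrite mulf_eq0 (negbTE wi) /= eq0.
Qed.

Lemma extract_flag F0 : flag_but inc F0 None -> flag_polytope posn.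
Proof.
move=> fl Fs Ff meet; pose S := [set f | facet_set f \in Fs].
have [f g|[v vS]|//] := fl S.
  by rewrite !inE => fS gS; have [x [xf xg]] := meet _ _ fS gS; apply: hull_meet xf xg.
exists (pos v) => _ /[dup] /Ff /facet_is_set[f ->] fS.
have vf : inc v f by apply: vS; rewrite inE.
exists (fun i => (i == enum_rank v)%:R); split.
- by move=> i; rewrite ler0n.
- move=> i; rewrite inE; case: eqP => // ->; rewrite enum_rankK vf //.
- rewrite (bigD1 (enum_rank v)) //= eqxx big1 ?addr0 // => i /negbTE->; by [].
- rewrite (bigD1 (enum_rank v)) //= eqxx scale1r big1 ?addr0 /posn ?enum_rankK // => i /negbTE->.
  by rewrite scale0r.
Qed.

End Realization.

(** * The tetrahedron and the conclusion *)

Local Open Scope nat_scope.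

Section Tetrahedron.
Variable R : realType.

Let T : finType := (bool * bool)%type.
(** The facet [f] is the one opposite the vertex [f]. *)
Let tinc (v f : T) : bool := v != f.
Let o : T := (false, false).
Let a : T := (false, true).
Let b : T := (true, false).
Let c : T := (true, true).

Let tring : seq (T * T) := [:: (a, c); (b, a); (c, b)].

Lemma tetra_simple : simple_inc tinc.
Proof.
split.
- move=> [p q]; exists (~~ p, q), (p, ~~ q), (~~ p, ~~ q).
  by split; [case: p q => [] [] | case: p q => [] [] [[] []]].
- move=> v f g fg vf vg.
  (* The fourth element: all elements of the Klein four-group add up to zero. *)
  pose w : T := (v.1 (+) f.1 (+) g.1, v.2 (+) f.2 (+) g.2).
  by exists w, w; move: fg vf vg; rewrite /w /tinc;
    case: v f g {w} => [[] []] [[] []] [[] []].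
- by move=> [p q]; exists (~~ p, q); case: p q => [] [].
- by move=> u v h; apply/eqP/negPn/negP => uv; have := h v uv; rewrite /tinc eqxx.
Qed.

Lemma tetra_ringed : ringed tinc o tring [::].
Proof.
by split=> //; [do !split => //; move=> [[] []] | move=> [[] []] | move=> [[] []]].
Qed.

(** Only the set of all four facets fails, and it contains [o] and [z]. *)
Lemma tetra_flag z : flag_but tinc o (Some z).
Proof.
move=> S _; have [oS|oS] := boolP (o \in S); last first.
  by left; exists o => f fS; apply: contraNneq oS => ->.
have [zS|zS] := boolP (z \in S); first by right.
by left; exists z => f fS; apply: contraNneq zS => ->.
Qed.

(** The value 3 is no coordinate index, so [o] is placed at the origin. *)
Let tcoord (v : T) : nat := if v == a then 0 else if v == b then 1 else if v == c then 2 else 3.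

Let tpos (v : T) : 'rV[R]_3 := (\row_j (tcoord v == j)%:R)%R.

Let tplane (f : T) : 'rV[R]_3 * R :=
  (if f == o then (const_mx 1, 1) else (- tpos f, 0))%R.

Lemma dot_sum (u v : 'rV[R]_3) : dot u v = (\sum_j u 0 j * v 0 j)%R.
Proof. by rewrite /dot mxE; apply: eq_bigr => j _; rewrite mxE. Qed.

(** The slacks are the barycentric coordinates. *)
Lemma tetra_realizes : realizes tinc tpos tplane.
Proof.
suff h v f : ev (tplane f) (tpos v) = (v == f)%:R%R.
  by move=> v f; rewrite h /tinc; case: (v == f); rewrite ?ler0n ?oner_eq0 ?eqxx.
rewrite /ev dot_sum !big_ord_recl big_ord0 /tplane.
by case: v f => [[] []] [[] []]; rewrite /= !mxE /=; ring.
Qed.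

Lemma tetra_convex : convex_cycle (tpos b) (tpos c) tpos (map fst tring).
Proof.
move=> p q r spqr; have /eqP[-> -> ->] : [:: p; q; r] == map fst tring.
  by rewrite -(size_subseq_leqif spqr).
by rewrite /turn !dot_sum !big_ord_recl !big_ord0 !mxE /=; lra.
Qed.

Lemma tetra_state : state R true [:: 3; 3; 3] [::].
Proof.
apply: (@State R true _ _ T T tinc o tring [::]) => //.
  split; [exact: tetra_simple | exact: tetra_ringed | exact: tetra_flag |].
  exists tpos, tplane, (tpos b), (tpos c).
  by split; [exact: tetra_realizes | exact: tetra_convex].
have s3 f : fsize tinc f = 3.
  rewrite /fsize -(pair_bigA _ (fun p q => tinc (p, q) f : nat)) /= big_bool !big_bool.
  by case: f => [[] []].
by rewrite /= !s3.
Qed.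

End Tetrahedron.

Lemma state_polytope (R : realType) (w D : seq nat) : state R false w D ->
  exists (n : nat) (pos : 'I_n -> 'rV[R]_3),
    [/\ is_polytope3 pos, simple_polytope pos, flag_polytope pos &
        forall k, k != 6 -> pk pos k = count_mem k (size w :: w ++ D)].
Proof.
case=> V F inc F0 rg ds [simp rd fl [pos [l [e1 [e2 [rl _]]]]]] wE pD.
have [v0 _] := simple_facet simp F0.
exists #|V|, (fun i => pos (enum_val i)); split.
- exact: extract_polytope simp rl v0.
- exact: extract_simple simp rl.
- exact: (extract_flag simp rl fl).
move=> k k6; rewrite (pk_fsize simp rl).
have szF0 : fsize inc F0 = size w.
  rewrite -wE !size_map /fsize; have /card_uniqP := ringed_uniqv rd; rewrite size_map => <-.
  rewrite -sum1_card [RHS]big_mkcond /=; apply: eq_bigr => v _.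
  by rewrite (ringed_memv rd); case: (_ \in _).
have pe : perm_eq (enum F) (F0 :: map snd rg ++ ds).
  apply: uniq_perm; [exact: enum_uniq | exact: ringed_uniqf rd |].
  by move=> f; rewrite mem_enum (ringed_memf rd).
have -> : #|[set f | fsize inc f == k]| = count_mem k (map (fsize inc) (enum F)).
  rewrite -sum1_count big_map big_enum_cond -sum1_card.
  by apply: eq_bigl => f; rewrite inE.
rewrite (permP (perm_map _ pe)) /= szF0 !map_cat wE !count_cat; congr (_ + (_ + _)).
rewrite -(permP pD) /non6 count_filter; apply: eq_count => d /=.
by have [->|] := eqVneq d k; rewrite ?k6.
Qed.

Lemma count_flatten_nseq (p : nat -> nat) s d : uniq s ->
  count_mem d (flatten [seq nseq (p k) k | k <- s]) = if d \in s then p d else 0.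
Proof.
elim: s => //= k s IH /andP[ks us]; rewrite count_cat count_nseq IH // in_cons /=.
have [->|dk] := eqVneq d k; last by rewrite mul0n add0n.
by rewrite mul1n (negbTE ks) addn0.
Qed.

Lemma excess_flatten_nseq (p : nat -> nat) s :
  excess (flatten [seq nseq (p k) k | k <- s]) = \sum_(k <- s) (k - 6) * p k.
Proof.
rewrite /excess big_flatten big_map; apply: eq_bigr => k _.
by rewrite big_nseq iter_addn_0.
Qed.

Theorem theorem3 (R : realType) (p : nat -> nat) (N : nat) :
  (forall k, (N <= k)%N -> p k = 0%N) ->
  p 3%N = 0%N ->
  (3 * p 3 + 2 * p 4 + p 5 = 12 + \sum_(7 <= k < N) (k - 6) * p k)%N ->
  exists (p6 n : nat) (pos : 'I_n -> 'rV[R]_3),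
    [/\ is_polytope3 pos, simple_polytope pos, flag_polytope pos &
        forall k, (3 <= k)%N -> pk pos k = (if k == 6%N then p6 else p k)].
Proof.
move=> pN p3 e; pose K := flatten [seq nseq (p k) k | k <- index_iota 7 N].
have K6 : all (fun k => 6 < k) K.
  apply/allP => d /flattenP[s /mapP[k]]; rewrite mem_index_iota => /andP[k7 _] ->.
  by move=> /nseqP[->].
have eK : (p 4).*2 + p 5 = 12 + excess K.
  by move: e; rewrite p3 excess_flatten_nseq -mul2n muln0 add0n.
have [m [E [m45 [w [E' [st pE]]] pK]]] := game_closes K6 eK.
have m3 : 3 < m by case: m45 => ->.
have := state_steps st (state_prism m3 (tetra_state R)).
move=> /state_polytope[n [pos [pp ps pf pkE]]].
exists (pk pos 6), n, pos; split=> // k k3; case: eqP => [->//|/eqP k6].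
rewrite pkE //.
have mE : non6 [:: m] = [:: m] by case: m45 => ->.
have cE s : count_mem k s = count_mem k (non6 s).
  rewrite /non6 count_filter; apply: eq_count => d /=.
  by have [->|] := eqVneq d k; rewrite ?k6.
have -> : count_mem k (size w :: w ++ E' ++ non6 [:: m]) = count_mem k (m :: E).
  rewrite mE -cat_cons -(cat1s m E) !count_cat cE -(permP pE) count_cat; lia.
rewrite (permP pK) !count_cat !count_nseq count_flatten_nseq ?iota_uniq // mem_index_iota /=.
case: k k3 k6 {cE} => [|[|[|[|[|[|[|k]]]]]]] //= _ _; rewrite ?p3 ?mul1n ?mul0n ?addn0 //.
by rewrite add0n; case: ltnP => // /pN ->.
Qed.
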